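(* Let $M$ be an $n$-dimensional manifold and let $\nabla$ be a torsion-free affine connection of class $C^1$ on $M$. Then $A_n=(M,\nabla)$ is (globally) projectively equiaffine; that is, there exists a torsion-free affine connection $\bar\nabla$ of class $C^1$, defined on all of $M$, such that $\bar A_n=(M,\bar\nabla)$ is an equiaffine manifold (its Ricci tensor is symmetric: $\overline{Ric}(X,Y)=\overline{Ric}(Y,X)$ for all tangent vectors $X,Y$) and $A_n=(M,\nabla)$ admits a geodesic mapping onto $\bar A_n=(M,\bar\nabla)$ (namely, the identity map of $M$ is a geodesic mapping from $A_n$ onto $\bar A_n$).
   Context: Manifolds are smooth, Hausdorff and paracompact (so that Riemannian metrics exist globally). An affine connection $\nabla$ is of class $C^1$ if its components are functions of class $C^1$ in all charts of $M$. It is torsion-free if $\nabla_XY-\nabla_YX=[X,Y]$ for all vector fields $X,Y$. The curvature tensor of $\nabla$ is $R(X,Y)Z=\nabla_X(\nabla_YZ)-\nabla_Y(\nabla_XZ)-\nabla_{[X,Y]}Z$, and the Ricci tensor is $Ric(X,Y)=\mathrm{trace}\{V\mapsto R(X,V)Y\}$. The tensor $\overline{Ric}$ is the Ricci tensor of $\bar\nabla$ defined in the same way. A manifold with torsion-free affine connection is called equiaffine if its Ricci tensor is symmetric. A diffeomorphism between two manifolds with affine connection is called a geodesic mapping if it maps every geodesic of the first to a geodesic of the second, geodesics being considered as curves up to reparametrization (canonical parameters need not be preserved). For torsion-free connections $\nabla,\bar\nabla$ on the same manifold $M$, the identity map $(M,\nabla)\to(M,\bar\nabla)$ is a geodesic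 mapping if and only if there is a linear form (one-form) $\psi$ on $M$ such that $\bar\nabla_XY=\nabla_XY+\psi(X)Y+\psi(Y)X$ for all vector fields $X,Y$ (the Levi-Civita equation). *)

(* Defs.v *)
From HB Require Import structures.
From mathcomp Require Import all_boot all_order all_algebra.
From mathcomp Require Import all_classical all_reals all_analysis.

Set Implicit Arguments.
Unset Strict Implicit.
Unset Printing Implicit Defensive.

Import Order.TTheory GRing.Theory Num.Theory.
Import numFieldNormedType.Exports.
Local Open Scope classical_set_scope.
Local Open Scope ring_scope.

Section Calculus.
Context {R : realType}.

(* C^k on an open set A.  Only used when V is finite-dimensional, where a
   differentiable map is C^(k+1) iff all its directional derivatives are C^k. *)
Fixpoint Ck {V W : normedModType R} (k : nat) (A : set V) (f : V -> W) : Prop :=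
  match k with
  | 0 => forall x, A x -> {for x, continuous f}
  | k'.+1 => (forall x, A x -> differentiable f x) /\
             (forall v, Ck k' A ('D_v f))
  end.

Definition smooth {V W : normedModType R} (A : set V) (f : V -> W) : Prop :=
  forall k, Ck k A f.

End Calculus.

Definition locally_finite {T : topologicalType} (V : set (set T)) : Prop :=
  forall x : T, exists2 N, nbhs x N &
    finite_set [set A | V A /\ A `&` N !=set0].

Definition paracompact (T : topologicalType) : Prop :=
  forall U : set (set T),
    (forall A, U A -> open A) -> \bigcup_(A in U) A = setT ->
  exists V : set (set T),
    [/\ forall A, V A -> open A,
        \bigcup_(A in V) A = setT,
        forall A, V A -> exists2 B, U B & A `<=` B &
        locally_finite V].

(* [cmap] and [cinv] are total functions; only [cmap] on [dom] and [cinv] on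
   [cmap @` dom] are meaningful. *)
Record chart (R : realType) (n : nat) (T : topologicalType) := Chart {
  dom : set T ;
  cmap : T -> 'rV[R]_n ;
  cinv : 'rV[R]_n -> T ;
  dom_open : open dom ;
  cod_open : open (cmap @` dom) ;
  cmapK : forall p, dom p -> cinv (cmap p) = p ;
  cmap_continuous : forall p, dom p -> {for p, continuous cmap} ;
  cinv_continuous : forall x, (cmap @` dom) x -> {for x, continuous cinv}
}.

Section Transition.
Context {R : realType} {n : nat} {T : topologicalType}.
Implicit Types c : chart R n T.

Definition cod c : set 'rV[R]_n := cmap c @` dom c.

Definition overlap c (c' : chart R n T) : set 'rV[R]_n :=
  cmap c @` (dom c `&` dom c').

Definition transition c (c' : chart R n T) : 'rV[R]_n -> 'rV[R]_n :=
  cmap c' \o cinv c.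

Definition compatible c (c' : chart R n T) : Prop :=
  smooth (overlap c c') (transition c c') /\
  smooth (overlap c' c) (transition c' c).

End Transition.

Record manifold (R : realType) (n : nat) := Manifold {
  carrier :> topologicalType ;
  atlas : set (chart R n carrier) ;
  manifold_hausdorff : hausdorff_space carrier ;
  manifold_paracompact : paracompact carrier ;
  atlas_cover : forall p : carrier, exists2 c, atlas c & dom c p ;
  atlas_compatible : forall c c', atlas c -> atlas c' -> compatible c c' ;
  atlas_maximal :
    forall c, (forall c', atlas c' -> compatible c c') -> atlas c
}.

Section Diffeomorphism.
Context {R : realType} {m n : nat}.

Definition smooth_map (M : manifold R m) (N : manifold R n) (f : M -> N) :
    Prop :=
  continuous f /\
  forall (c : chart R m M) (d : chart R n N), atlas c -> atlas d ->
    smooth (cmap c @` (dom c `&` f @^-1` dom d)) (cmap d \o f \o cinv c).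

End Diffeomorphism.

Definition diffeomorphism {R : realType} {m n : nat}
    (M : manifold R m) (N : manifold R n) (f : M -> N) : Prop :=
  smooth_map f /\
  exists g : N -> M, [/\ cancel f g, cancel g f & smooth_map g].

Section LocalOperators.
Context {R : realType} {n : nat}.

(* In a chart, a vector field X = sum_i X^i d_i is its component function
   'rV_n -> 'rV_n, and a connection is its component functions
   G x k i j = Gamma^k_(ij)(x), where nabla_(d_i) d_j = sum_k Gamma^k_(ij) d_k. *)
Definition vecfun := 'rV[R]_n -> 'rV[R]_n.
Definition components := 'rV[R]_n -> 'I_n -> 'I_n -> 'I_n -> R.
Implicit Types (G : components) (X Y Z : vecfun) (x u v : 'rV[R]_n).

Definition Gamma G x u v : 'rV[R]_n :=
  \row_k \sum_i \sum_j G x k i j * u 0 i * v 0 j.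

Definition cov G X Y : vecfun :=
  fun x => 'D_(X x) Y x + Gamma G x (X x) (Y x).

Definition lie_bracket X Y : vecfun :=
  fun x => 'D_(X x) Y x - 'D_(Y x) X x.

Definition curvature G X Y Z : vecfun :=
  fun x => cov G X (cov G Y Z) x - cov G Y (cov G X Z) x
           - cov G (lie_bracket X Y) Z x.

(* R is a tensor, so its value on tangent vectors at a point is computed on any
   vector fields extending them near this point; here the extensions are the
   fields with constant components in the chart. *)
Definition curvature_at G x u v w : 'rV[R]_n :=
  curvature G (fun=> u) (fun=> v) (fun=> w) x.

(* Ric(u, v) = trace (w |-> R(u, w) v) *)
Definition Ric G x u v : R := \tr (lin1_mx (fun w => curvature_at G x u w v)).

End LocalOperators.

Section Connections.
Context {R : realType} {n : nat} (M : manifold R n).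

(* A smooth vector field on M, given by its components X c in each chart c. *)
Record vector_field := VectorField {
  vf :> chart R n M -> 'rV[R]_n -> 'rV[R]_n ;
  vf_smooth : forall c, atlas c -> smooth (cod c) (vf c) ;
  vf_transform : forall c c', atlas c -> atlas c' ->
    forall x, overlap c c' x ->
      vf c' (transition c c' x) = 'D_(vf c x) (transition c c') x
}.

(* An affine connection, given by its components in each chart; the
   transformation law is that of Christoffel symbols, i.e. it says that the
   local expressions [cov] of nabla_X Y in the various charts are those of one
   and the same vector field. *)
Record affine_connection := AffineConnection {
  christoffel :> chart R n M -> 'rV[R]_n -> 'I_n -> 'I_n -> 'I_n -> R ;
  christoffel_transform : forall c c', atlas c -> atlas c' ->
    forall x u v, overlap c c' x ->
      let tau := transition c c' in
      'D_u ('D_v tau) x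
        + Gamma (christoffel c') (tau x) ('D_u tau x) ('D_v tau x)
      = 'D_(Gamma (christoffel c) x u v) tau x
}.

Definition connection_C1 (nabla : affine_connection) : Prop :=
  forall c, atlas c -> forall k i j,
    Ck 1 (cod c) (fun x => nabla c x k i j : R^o).

Definition torsion_free (nabla : affine_connection) : Prop :=
  forall (X Y : vector_field) c, atlas c -> forall x, cod c x ->
    cov (nabla c) (X c) (Y c) x - cov (nabla c) (Y c) (X c) x
    = lie_bracket (X c) (Y c) x.

(* Tangent vectors at a point of dom c are given by their components u, v.
   Only used for torsion-free connections. *)
Definition equiaffine (nabla : affine_connection) : Prop :=
  forall c, atlas c -> forall x u v, cod c x ->
    Ric (nabla c) x u v = Ric (nabla c) x v u.

(* A geodesic with its canonical parameter, defined on the open interval I. *)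
Definition geodesic (nabla : affine_connection) (I : set R) (g : R -> M) :
    Prop :=
  [/\ open I, is_interval I,
      forall t, I t -> {for t, continuous g} &
      forall c, atlas c ->
        let x : R^o -> 'rV[R]_n := cmap c \o g in
        let dx : R^o -> 'rV[R]_n := derive1 x in
        Ck 2 (I `&` g @^-1` dom c) x /\
        forall t, I t -> dom c (g t) ->
          derive1 dx t + Gamma (nabla c) (x t) (dx t) (dx t) = 0].

End Connections.

(* [h] maps the open interval J diffeomorphically onto I. *)
Definition reparametrization {R : realType} (J I : set R) (h : R -> R) : Prop :=
  [/\ open J, is_interval J, h @` J = I,
      Ck 2 J (h : R^o -> R^o) & forall s, J s -> derive1 h s != 0].

Definition geodesic_mapping {R : realType} {m n : nat}
    (M : manifold R m) (nabla : affine_connection M)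
    (N : manifold R n) (nabla' : affine_connection N) (f : M -> N) : Prop :=
  diffeomorphism f /\
  forall (I : set R) (g : R -> M), geodesic nabla I g ->
    exists (J : set R) (h : R -> R),
      reparametrization J I h /\ geodesic nabla' J (f \o g \o h).

(* Main.v *)
From HB Require Import structures.
Require Import Defs.
From mathcomp Require Import all_boot all_order all_algebra.
From mathcomp Require Import all_classical all_reals all_analysis.
From mathcomp Require Import ring lra.

Set Implicit Arguments.
Unset Strict Implicit.
Unset Printing Implicit Defensive.

Import Order.TTheory GRing.Theory Num.Theory.
Import numFieldNormedType.Exports.
Local Open Scope classical_set_scope.
Local Open Scope ring_scope.

(** For a torsion-free connection the antisymmetric part of the Ricci tensor is
    the exterior derivative of the contracted Christoffel symbols [T_c(u) = tr (v |-> Gamma (u, v))] of a chart [c]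
    ([Ric_sym]).  A projective change by a one-form [psi] replaces [T] by
    [T + (n + 1) psi] ([tr_conn_form_change]), so it suffices to find a global
    one-form [psi] for which this sum is closed in every chart.

    Under a change of chart [T] is not a covector: it picks up the logarithmic
    derivative of the Jacobian determinant ([tr_conn_form_transition]).  The
    logarithmic derivative of a positive density picks up the same term
    ([derive_dens_transition]).  Hence, for a positive smooth density [d] of
    weight two, i.e. with [d_c = (d_c' o tau) (det D tau)^2],
<<
      psi (u) = (D_u d / (2 d) - T (u)) / (n + 1)
>>
    is a one-form on the whole manifold ([psi_transform]).  After the change
    [T] becomes [D_u d / (2 d)], half the differential of [log d], which is
    closed by the symmetry of second derivatives ([derive_schwarz]); so the new
    Ricci tensor is symmetric.  Weight two makes the determinant appear squared,
    which avoids absolute values and orientability.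

    A positive density exists because densities, like functions, can be added
    and extended by zero ([positive_density]): paracompactness yields a locally
    finite cover by relatively compact open sets and compact sets inside its
    members that still cover; on each of these a finite sum of bump densities is
    positive.  Bump functions are also what turns absence of torsion, a
    statement on global vector fields, into symmetry of the Christoffel symbols
    ([torsion_free_sym]).

    Finally, a geodesic [g] of the old connection, reparametrized by [h], is a
    geodesic of the new one as soon as [h'' = - 2 psi (g' o h) h'^2].  The
    inverse of a primitive of [exp (2 P)], where [P' = psi (g')], solves this
    equation ([geodesic_reparametrization]). *)

(** * Derivatives and the classes C^k *)

Section DifferentialRules.
Context {R : realType}.
Implicit Types U V W : normedModType R.

Lemma near_eq_differentiable V W (f g : V -> W) x :
  (\near x, f x = g x) -> differentiable f x -> differentiable g x.
Proof.
move=> fg df; have fgx := nbhs_singleton fg.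
suff dh : differentiable (g - f) x.
  have -> : g = f + (g - f) by rewrite addrCA subrr addr0.
  exact: differentiableD.
have h0 : (g - f) \o shift x = cst ((g - f) x) + \0 +o_ 0 id.
  apply/eqaddoP => e e0.
  have : \forall y \near (0 : V), f (y + x) = g (y + x).
    move: fg; rewrite (near_shift 0)/=; apply: filterS => y /=.
    by rewrite subr0.
  apply: filterS => y fgy.
  rewrite /cst !fctE /= !fgy fgx !subrr addr0 subr0 normr0.
  by rewrite mulr_ge0// ltW.
apply/diff_locallyP.
have -> : 'd (g - f) x = \0 :> (V -> W).
  apply: (@diff_unique R V W (g - f) \0) => //.
  by move=> y; exact: cvg_cst.
by split=> // y; exact: cvg_cst.
Unshelve. all: by end_near. Qed.

(** Scalar multiplication as a function of two arguments, to carry the bilinear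
    structure from which the product rule is derived. *)
Definition scaling W (a : R^o) (w : W) : W := a *: w.

Lemma scaling_is_bilinear W :
  bilinear_for
    (GRing.Scale.Law.clone _ _ *:%R _) (GRing.Scale.Law.clone _ _ *:%R _)
    (@scaling W).
Proof.
split=> [w|a] b x y /=; first by rewrite /scaling scalerDl scalerA.
by rewrite /scaling scalerDr !scalerA mulrC.
Qed.

HB.instance Definition _ W := bilinear_isBilinear.Build R R^o W W _ _
  (@scaling W) (scaling_is_bilinear W).

(** The product rule, as the differential of a bilinear map composed with a
    pair. *)
Lemma diff_scale V W (a : V -> R^o) (f : V -> W) x :
  differentiable a x -> differentiable f x ->
  differentiable (fun y => a y *: f y) x /\
  forall v, 'd (fun y => a y *: f y) x v = a x *: 'd f x v + 'd a x v *: f x.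
Proof.
move=> da df.
pose b : {bilinear R^o -> W -> W} := @scaling W.
have bc : continuous (fun p : R^o * W => b p.1 p.2).
  by move=> p; exact: (@scale_continuous R W p).
have dp := differentiable_pair da df.
have dbp := @differentiable_bilin R R^o W W b (a x, f x) bc.
have -> : (fun y => a y *: f y) = (fun p => b p.1 p.2) \o (fun y => (a y, f y)).
  by [].
split; first exact: differentiable_comp.
by move=> v; rewrite diff_comp//= diff_bilin// diff_pair.
Qed.

Lemma derive_scale V W (a : V -> R^o) (f : V -> W) x v :
  differentiable a x -> differentiable f x ->
  'D_v (fun y => a y *: f y) x = a x *: 'D_v f x + 'D_v a x *: f x.
Proof.
by move=> da df; have [d e] := diff_scale da df; rewrite !deriveE// e.
Qed.

Lemma derive_lin V W W' (L : {linear W -> W'}) (f : V -> W) x v :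
  continuous L -> differentiable f x -> 'D_v (L \o f) x = L ('D_v f x).
Proof.
move=> Lc df; have dL := linear_differentiable (f x) Lc.
by rewrite !deriveE//; [rewrite diff_comp// diff_lin|exact: differentiable_comp].
Qed.

Lemma derive_comp U V W (f : U -> V) (g : V -> W) x u :
  differentiable f x -> differentiable g (f x) ->
  'D_u (g \o f) x = 'D_('D_u f x) g (f x).
Proof.
move=> df dg; rewrite !deriveE//; first by rewrite diff_comp.
exact: differentiable_comp.
Qed.

Lemma derive_scaler V W (f : V -> W) x (a : R) u :
  differentiable f x -> 'D_(a *: u) f x = a *: 'D_u f x.
Proof. by move=> df; rewrite !deriveE// linearZ. Qed.

Lemma derive_addr V W (f : V -> W) x u v :
  differentiable f x -> 'D_(u + v) f x = 'D_u f x + 'D_v f x.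
Proof. by move=> df; rewrite !deriveE// linearD. Qed.

End DifferentialRules.

Section CkCalculus.
Context {R : realType}.
Implicit Types U V W : normedModType R.

Lemma Ck_ext V W k (A : set V) (f g : V -> W) : open A ->
  (forall x, A x -> f x = g x) -> Ck k A f -> Ck k A g.
Proof.
move=> oA; elim: k f g => [|k IH] f g fg.
  move=> fc x Ax; have nA : \forall y \near x, f y = g y.
    by apply: filterS (open_nbhs_nbhs (conj oA Ax)) => y; exact: fg.
  have := fc x Ax; rewrite /prop_for /continuous_at (fg x Ax).
  by apply: cvg_trans; apply: near_eq_cvg; apply: filterS nA => y ->.
move=> [df Df]; have nA x : A x -> \forall y \near x, f y = g y.
  by move=> Ax; apply: filterS (open_nbhs_nbhs (conj oA Ax)) => y; exact: fg.
split=> [x Ax|v]; first exact: near_eq_differentiable (nA x Ax) (df x Ax).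
by apply: (IH ('D_v f)) (Df v) => x Ax; exact: near_eq_derive (nA x Ax).
Qed.

Lemma Ck_sub V W k (A B : set V) (f : V -> W) : B `<=` A -> Ck k A f -> Ck k B f.
Proof.
move=> BA; elim: k f => [|k IH] f /= => [fc x /BA /fc//|[df Df]].
by split=> [x /BA /df//|v]; exact: IH (Df v).
Qed.

Lemma CkS V W k (A : set V) (f : V -> W) : Ck k.+1 A f -> Ck k A f.
Proof.
elim: k f => [|k IH] f /= [df Df].
  by move=> x /df; exact: differentiable_continuous.
by split=> // v; exact: IH (Df v).
Qed.

Lemma Ck_continuous V W k (A : set V) (f : V -> W) x :
  Ck k A f -> A x -> {for x, continuous f}.
Proof. by elim: k => [|k IH]; [exact|move=> /CkS]. Qed.

(** Being of class C^k is local; this is how functions defined by cases on a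
    manifold are shown to be smooth. *)
Lemma Ck_local V W k (A : set V) (f : V -> W) :
  (forall x, A x -> exists2 N, nbhs x N & Ck k N f) -> Ck k A f.
Proof.
elim: k f => [|k IH] f Nf.
  by move=> x /Nf [N Nx /(_ x (nbhs_singleton Nx))].
split=> [x /Nf [N Nx [df _]]|v]; first exact: df (nbhs_singleton Nx).
by apply: IH => x /Nf [N Nx [_ Df]]; exists N => //; exact: Df.
Qed.

Lemma Ck_cst V W k (A : set V) (w : W) : Ck k A (fun=> w).
Proof.
elim: k w => [|k IH] w; first by move=> x _; exact: cvg_cst.
split=> [x _|v]; first exact: differentiable_cst.
have -> : 'D_v (fun=> w) = (fun=> 0) :> (V -> W).
  by apply/funext => x; exact: derive_cst.
exact: IH.
Qed.

Lemma Ck_lin V W W' k (A : set V) (L : {linear W -> W'}) (f : V -> W) : open A ->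
  continuous L -> Ck k A f -> Ck k A (L \o f).
Proof.
move=> oA Lc; elim: k f => [|k IH] f /=.
  by move=> fc x /fc fx; apply: continuous_comp => //; exact: Lc.
move=> [df Df]; split=> [x /df dfx|v].
  by apply: differentiable_comp => //; exact: linear_differentiable.
apply: (@Ck_ext _ _ _ _ (L \o 'D_v f)) => //; last exact: IH (Df v).
  by move=> x /df dfx /=; rewrite derive_lin.
Qed.

Lemma Ck_id V k (A : set V) : Ck k A (fun x => x).
Proof.
case: k => [|k]; first by move=> x _; exact: cvg_id.
split=> [x _|v]; first exact: ex_diff.
have -> : 'D_v (fun x => x) = (fun=> v) :> (V -> V).
  by apply/funext => x; exact: derive_id.
exact: Ck_cst.
Qed.

Lemma CkD V W k (A : set V) (f g : V -> W) : open A ->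
  Ck k A f -> Ck k A g -> Ck k A (fun x => f x + g x).
Proof.
move=> oA; elim: k f g => [|k IH] f g /=.
  by move=> fc gc x Ax; apply: cvgD; [exact: fc|exact: gc].
move=> [df Df] [dg Dg]; split=> [x Ax|v].
  by apply: differentiableD; [exact: df|exact: dg].
apply: (@Ck_ext _ _ _ _ (fun x => 'D_v f x + 'D_v g x)) => //; last exact: IH (Df v) (Dg v).
move=> x Ax; symmetry; apply: deriveD; apply: diff_derivable.
  exact: df.
exact: dg.
Qed.

Lemma Ck_sum V W k (A : set V) I (r : seq I) (P : pred I) (f : I -> V -> W) :
  open A -> (forall i, P i -> Ck k A (f i)) ->
  Ck k A (fun x => \sum_(i <- r | P i) f i x).
Proof.
move=> oA fC; elim: r => [|i r IH].
  by apply: Ck_ext (Ck_cst _ _ 0) => // x _; rewrite big_nil.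
have [Pi|nPi] := boolP (P i).
  by apply: Ck_ext (CkD oA (fC i Pi) IH) => // x _; rewrite big_cons Pi.
by apply: Ck_ext IH => // x _; rewrite big_cons (negbTE nPi).
Qed.

Lemma Ck_scale V W k (A : set V) (a : V -> R^o) (f : V -> W) : open A ->
  Ck k A a -> Ck k A f -> Ck k A (fun x => a x *: f x).
Proof.
move=> oA; elim: k a f => [|k IH] a f.
  by move=> ac fc x Ax; apply: cvgZ; [exact: ac|exact: fc].
move=> Ca Cf; have [[da Da] [df Df]] := (Ca, Cf); split=> [x Ax|v].
  by have [] := diff_scale (da x Ax) (df x Ax).
apply: (@Ck_ext _ _ _ _ (fun x => a x *: 'D_v f x + 'D_v a x *: f x)) => //.
  by move=> x Ax; rewrite derive_scale//; [exact: da|exact: df].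
by apply: CkD => //; apply: IH => //; solve [exact: CkS | exact: Df | exact: Da].
Qed.

Lemma CkM V k (A : set V) (f g : V -> R^o) : open A ->
  Ck k A f -> Ck k A g -> Ck k A (fun x => f x * g x : R^o).
Proof. exact: Ck_scale. Qed.

Lemma CkN V W k (A : set V) (f : V -> W) : open A ->
  Ck k A f -> Ck k A (fun x => - f x).
Proof.
move=> oA fC; have := Ck_scale oA (Ck_cst _ _ (-1 : R^o)) fC.
by apply: Ck_ext => // x _; rewrite scaleN1r.
Qed.

Lemma CkB V W k (A : set V) (f g : V -> W) : open A ->
  Ck k A f -> Ck k A g -> Ck k A (fun x => f x - g x).
Proof. by move=> oA fC gC; apply: CkD => //; exact: CkN. Qed.

Lemma Ck_prod V k (A : set V) I (r : seq I) (f : I -> V -> R^o) :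
  open A -> (forall i, Ck k A (f i)) ->
  Ck k A (fun x => \prod_(i <- r) f i x : R^o).
Proof.
move=> oA fC; elim: r => [|i r IH].
  by apply: Ck_ext (Ck_cst _ _ (1 : R^o)) => // x _; rewrite big_nil.
by apply: Ck_ext (CkM oA (fC i) IH) => // x _; rewrite big_cons.
Qed.

(** A finite basis with its dual forms.  It is needed because [Ck] differentiates
    along constant directions only: the chain rule expresses the derivative of a
    composite along a constant direction by the derivatives of the outer function
    along the vectors of a basis. *)
Record coordinates (V : normedModType R) := Coordinates {
  cdim : nat ;
  cbasis : 'I_cdim -> V ;
  cform : 'I_cdim -> {linear V -> R^o} ;
  cform_continuous : forall i, continuous (cform i) ;
  coordinatesE : forall x, x = \sum_i cform i x *: cbasis i
}.

Arguments cbasis {V} c i.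
Arguments cform {V} c i.

Lemma Ck_coordP V W (C : coordinates W) k (A : set V) (f : V -> W) : open A ->
  Ck k A f <-> forall i, Ck k A (cform C i \o f).
Proof.
move=> oA; split=> [fC i|fC].
  by apply: Ck_lin => //; exact: cform_continuous.
have := @Ck_sum V W k A _ (index_enum _) xpredT _ oA
  (fun i _ => Ck_scale oA (fC i) (Ck_cst _ _ (cbasis C i))).
by apply: Ck_ext => // x _; rewrite /= -coordinatesE.
Qed.

Lemma Ck_comp U V W (C : coordinates V) k (A : set U) (B : set V)
    (f : U -> V) (g : V -> W) : open A -> (forall x, A x -> B (f x)) ->
  Ck k A f -> Ck k B g -> Ck k A (g \o f).
Proof.
move=> oA AB; elim: k g f AB => [|k IH] g f AB fC gC.
  by move=> x Ax; apply: continuous_comp; [exact: fC|exact: gC (AB _ Ax)].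
have [[df Df] [dg Dg]] := (fC, gC); split=> [x Ax|v].
  by apply: differentiable_comp; [exact: df|exact: dg (AB _ Ax)].
apply: (@Ck_ext _ _ _ _ (fun x => \sum_(i : 'I_(cdim C)) cform C i ('D_v f x) *:
   'D_(cbasis C i) g (f x))) => //.
  move=> x Ax; rewrite derive_comp//; [|exact: df|exact: dg (AB _ Ax)].
  have dgx := dg _ (AB _ Ax).
  rewrite [in RHS](coordinatesE C ('D_v f x)) [RHS]deriveE// linear_sum.
  by apply: eq_bigr => i _; rewrite linearZ /= (deriveE (cbasis C i) dgx).
apply: Ck_sum => // i _; apply: Ck_scale => //.
  by have /(@Ck_coordP _ _ C _ _ _ oA) := Df v; exact.
by apply: (IH ('D_(cbasis C i) g)); [exact: AB|exact: CkS|exact: Dg].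
Qed.

End CkCalculus.

(** * A smooth bump function *)

Section Bump.
Context {R : realType}.

(** The functions P(1/x) exp(-1/x), extended by zero to the left of the origin.
    The polynomial factor makes the family stable under differentiation, so that
    one computation of a derivative proves smoothness of all its members. *)
Definition flat (P : {poly R}) (x : R) : R :=
  if 0 < x then P.[x^-1] * expR (- x^-1) else 0.

(** Each monomial is dominated by one term of the exponential series. *)
Lemma horner_expRN_bounded (P : {poly R}) :
  exists2 C, 0 <= C & forall y, 0 <= y -> `|P.[y] * expR (- y)| <= C.
Proof.
have mono n (y : R) : 0 <= y -> y ^+ n * expR (- y) <= n`!%:R.
  move=> y0; rewrite expRN ler_pdivrMr ?expR_gt0//.
  case: n => [|n].
    by rewrite expr0 fact0 mul1r (le_trans _ (expR_ge1Dx y))// lerDl.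
  rewrite mulrC -ler_pdivrMr ?ltr0n ?fact_gt0//.
  by rewrite (le_trans _ (expR_ge1Dxn n y0))// lerDr.
exists (\sum_(i < size P) `|P`_i| * i`!%:R).
  by apply: sumr_ge0 => i _; rewrite mulr_ge0.
move=> y y0; rewrite horner_coef mulr_suml (le_trans (ler_norm_sum _ _ _))//.
apply: ler_sum => i _; rewrite -mulrA normrM ler_wpM2l//.
by rewrite ger0_norm ?mono// mulr_ge0 ?exprn_ge0 ?expR_ge0.
Qed.

(** Writing P(1/x) as x^2 times the value at 1/x of P 'X^2 and bounding the
    latter: this makes the difference quotient at the origin vanish. *)
Lemma flat_le_sqr P : exists2 C, 0 <= C & forall x, `|flat P x| <= C * x ^+ 2.
Proof.
have [C C0 PC] := horner_expRN_bounded (P * 'X^2).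
exists C => // x; rewrite /flat; case: ifPn => [x0|_]; last first.
  by rewrite normr0 mulr_ge0 ?sqr_ge0.
rewrite -ler_pdivrMr ?exprn_gt0//.
have := PC x^-1; rewrite invr_ge0 (ltW x0) => /(_ isT); apply: le_trans.
rewrite hornerM hornerXn mulrAC [X in _ <= X]normrM (ger0_norm (sqr_ge0 _)) exprVn.
by [].

Qed.

Lemma is_derive_flat P (x : R) :
  is_derive x 1 (flat P) (flat ((P - P^`()) * 'X^2) x).
Proof.
have [x0|x0|->] := ltgtP x 0.
- rewrite /flat ltNge (ltW x0)/=.
  apply: (near_eq_is_derive (f := cst 0)) => //.
  near=> y; rewrite /cst ltNge ltW//=; near: y; exact: lt_nbhsl.
- pose f y : R := P.[y^-1] * expR (- y^-1).
  apply: (near_eq_is_derive (f := f)).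
    by near=> y; rewrite /flat ifT//; near: y; exact: lt_nbhsr.
  rewrite /flat x0.
  have dV : is_derive x 1 (fun y : R => y^-1) (- x ^- 2 *: 1).
    by apply: is_deriveV; rewrite gt_eqF.
  have d1 : is_derive x 1 (horner P \o (fun y : R => y^-1)) _ :=
    is_derive1_comp (is_derive_poly P x^-1) dV.
  have d2 : is_derive x 1 (expR \o (fun y : R => - y^-1)) _ :=
    @is_derive1_comp R expR (fun y => - y^-1) x _ _
      (is_derive_expR (- x^-1)) (is_deriveN dV).
  apply: is_derive_eq (is_deriveM d1 d2) _.
  rewrite hornerM hornerD hornerN hornerXn /= /GRing.scale /= -exprVn.
  by ring.
- have [C C0 PC] := flat_le_sqr P.
  rewrite [flat _ 0]/flat ltxx.
  have F0 : flat P 0 = 0 by rewrite /flat ltxx.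
  suff L : (fun h : R => h^-1 *: (flat P (h *: 1 + 0) - flat P 0)) @ 0^' --> (0 : R).
    by split; [apply/cvg_ex; exists 0|apply/cvg_lim].
  apply: norm_cvg0.
  apply: (@squeeze_cvgr _ _ _ _ (cst 0) (fun h => C * `|h|)).
  + near=> h; rewrite /= normr_ge0 /= F0 subr0 addr0 [h *: 1]mulr1 normrM.
    have h0 : h != 0 by near: h; exact: nbhs_dnbhs_neq.
    rewrite normfV ler_pdivrMl ?normr_gt0//.
    by rewrite (le_trans (PC h))// [leRHS]mulrCA -expr2 real_normK// num_real.
  + exact: cvg_cst.
  + rewrite -[X in _ --> X](mulr0 C); apply: cvgMr.
    rewrite -[X in _ --> X](@normr0 _ R); apply: cvg_norm.
    exact: nbhs_dnbhs.
Unshelve. all: by end_near. Qed.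

Lemma smooth_flat P : smooth setT (flat P : R^o -> R^o).
Proof.
move=> k; elim: k P => [|k IH] P.
  move=> x _; apply: differentiable_continuous.
  by apply/derivable1_diffP; have [] := is_derive_flat P x.
have df (x : R^o) : differentiable (flat P : R^o -> R^o) x.
  by apply/derivable1_diffP; have [] := is_derive_flat P x.
split=> // v; have := Ck_scale openT (Ck_cst k setT (v : R^o))
   (IH ((P - P^`()) * 'X^2)).
apply: Ck_ext; first exact: openT.
move=> x _; have [_ <-] := is_derive_flat P x.
by rewrite !deriveE// -linearZ /= [v *: 1]mulr1.
Qed.

Definition scalar_coordinates : coordinates R^o.
Proof.
apply: (@Coordinates R R^o 1 (fun=> 1) (fun=> idfun)).
  by move=> i x; exact: cvg_id.
by move=> x; rewrite big_ord1 /= [_ *: _]mulr1.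
Defined.

Section rowCoordinates.
Variable n : nat.

Definition entry (i : 'I_n) (v : 'rV[R]_n) : R^o := v 0 i.

Lemma entry_is_linear i : linear (entry i).
Proof. by move=> a u v; rewrite /entry !mxE. Qed.

HB.instance Definition _ i := GRing.isLinear.Build _ _ _ _ _ (entry_is_linear i).

Lemma entry_continuous i : continuous (entry i).
Proof. by move=> x; exact: coord_continuous. Qed.

Definition row_coordinates : coordinates 'rV[R]_n.
Proof.
apply: (@Coordinates R 'rV[R]_n n (fun i => 'e_i) entry entry_continuous).
by move=> x; exact: row_sum_delta.
Defined.

Lemma Ck_rowP (V : normedModType R) k (A : set V) (f : V -> 'rV[R]_n) :
  open A -> Ck k A f <-> forall i, Ck k A (fun x => f x 0 i : R^o).
Proof. exact: (Ck_coordP row_coordinates). Qed.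

(** The function [flat 1] applied to r^2 minus the squared Euclidean distance.
    The Euclidean ball is contained in the ball of the maximum norm. *)
Lemma smooth_bump (a : 'rV[R]_n) (r : R) : 0 < r ->
  exists b : 'rV[R]_n -> R^o, [/\ smooth setT b, forall x, 0 <= b x, 0 < b a &
    forall x, b x != 0 -> ball a r x].
Proof.
move=> r0; pose q (x : 'rV[R]_n) : R^o := r ^+ 2 - \sum_i (x 0 i - a 0 i) ^+ 2.
exists (flat 1 \o q); split.
- move=> k; apply: (Ck_comp scalar_coordinates openT (B := setT)) => //; last first.
    exact: smooth_flat.
  have Cd i : Ck k setT (fun x : 'rV[R]_n => x 0 i - a 0 i : R^o).
    apply: CkB (Ck_cst _ _ _); first exact: openT.
    by move: i; apply/Ck_rowP; [exact: openT|exact: Ck_id].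
  apply: CkB (Ck_cst _ _ _) _; first exact: openT.
  apply: Ck_sum => [|i _]; first exact: openT.
  by apply: CkM; [exact: openT|exact: Cd|exact: Cd].
- by move=> x; rewrite /flat /=; case: ifP => // _; rewrite mulr_ge0 ?hornerC ?expR_ge0.
- rewrite /flat /= /q big1 => [|i _]; last by rewrite subrr expr0n.
  by rewrite subr0 exprn_gt0// hornerC mul1r expR_gt0.
- move=> x; rewrite /flat /=; case: ifPn => [|_]; last by rewrite eqxx.
  rewrite subr_gt0 => qr _; rewrite -ball_normE /=.
  rewrite [ltLHS]/Num.Def.normr/= mx_normrE bigmax_lt//= => -[j i] _ /=.
  rewrite !mxE !ord1 distrC -(@ltr_pXn2r _ 2) ?nnegrE ?(ltW r0)//.
  rewrite real_normK ?num_real// (le_lt_trans _ qr)//.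
  by rewrite (bigD1 i)//= lerDl sumr_ge0// => k _; exact: sqr_ge0.
Qed.

End rowCoordinates.
End Bump.

(** * Inverses, symmetry of second derivatives, derivative of the determinant *)

Section Inverse.
Context {R : realType}.

Lemma Ck_inv k : Ck k [set x : R^o | x != 0] (fun x : R^o => x^-1 : R^o).
Proof.
have o0 : open [set x : R^o | x != 0].
  have -> : [set x : R^o | x != 0] = ~` [set 0 : R^o].
    by apply/seteqP; split=> x /= /eqP.
  exact/closed_openC/closed_eq.
elim: k => [|k IH].
  by move=> x x0; exact: inv_continuous.
have dV (x : R^o) : x != 0 -> is_derive x 1 (fun y : R => y^-1) (- x ^- 2 *: 1).
  by move=> x0; exact: is_deriveV.
have df (x : R^o) : x != 0 -> differentiable (fun y : R^o => y^-1 : R^o) x.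
  by move=> /dV ?; exact/derivable1_diffP.
split=> // v; have := Ck_scale o0 (Ck_cst k _ (- v : R^o)) (CkM o0 IH IH).
apply: Ck_ext => // x x0; rewrite deriveE; last exact: df.
rewrite -[v in RHS]mulr1 [in RHS]linearZ /= -deriveE; last exact: df.
have [_ ->] := dV x x0.
by rewrite /GRing.scale /= expr2 invfM; ring.
Qed.

Lemma CkV (V : normedModType R) k (A : set V) (f : V -> R^o) : open A ->
  (forall x, A x -> f x != 0) -> Ck k A f -> Ck k A (fun x => (f x)^-1 : R^o).
Proof.
move=> oA f0 fC.
exact: (Ck_comp (@scalar_coordinates R) oA f0 fC (Ck_inv k)).
Qed.

End Inverse.

Section Schwarz.
Context {R : realType} {V : normedModType R}.
Implicit Types (f : V -> R^o) (x u v : V).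

Lemma is_derive_line (W : normedModType R) (f : V -> W) x u (s : R) :
  differentiable f (x + s *: u) ->
  is_derive (s : R^o) 1 (fun s : R^o => f (x + s *: u)) ('D_u f (x + s *: u)).
Proof.
move=> df; pose l (s : R^o) := x + s *: u.
have dl : is_diff (s : R^o) l (cst 0 + *:%R ^~ u) by exact: is_diffD.
have dl1 : 'D_1 l (s : R^o) = u.
  by rewrite deriveE// diff_val fctE /= add0r scale1r.
have dfl : differentiable (f \o l) (s : R^o) by exact: differentiable_comp.
split; first exact: diff_derivable.
by rewrite -[LHS]/('D_1 (f \o l) s) derive_comp// dl1.
Qed.

(** Two applications of the mean value theorem, first along [u], then along [v].
    The second difference on the left is symmetric in [u] and [v]. *)
Lemma second_difference (A : set V) f x u v (h : R) : 0 < h -> Ck 2 A f ->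
  (forall s t, 0 <= s <= h -> 0 <= t <= h -> A (x + s *: u + t *: v)) ->
  exists s t, [/\ 0 <= s <= h, 0 <= t <= h &
    f (x + h *: u + h *: v) - f (x + h *: u) - (f (x + h *: v) - f x)
    = 'D_v ('D_u f) (x + s *: u + t *: v) * h * h].
Proof.
move=> h0 [df Df] Ah; have [dDf _] := Df u.
pose g s : R := f (x + h *: v + s *: u) - f (x + s *: u).
pose dg s := 'D_u f (x + h *: v + s *: u) - 'D_u f (x + s *: u).
have h0h : 0 <= h <= h by rewrite ltW//=.
have A0 s : 0 <= s <= h -> A (x + s *: u).
  by move=> sh; rewrite -[X in A X]addr0 -(scale0r v); apply: Ah => //; rewrite lexx ltW.
have A1 s : 0 <= s <= h -> A (x + h *: v + s *: u).
  by move=> sh; rewrite addrAC; exact: Ah.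
have gd s : 0 <= s <= h -> is_derive s 1 g (dg s).
  move=> sh; apply: is_deriveB; apply: is_derive_line; apply: df;
    [exact: A1|exact: A0].
have [s sh gs] : exists2 s, s \in `]0, h[%R & g h - g 0 = dg s * (h - 0).
  apply: (@MVT R g dg) => // [s|].
    by rewrite in_itv /= => /andP[/ltW ? /ltW ?]; apply: gd; apply/andP.
  apply: derivable_within_continuous => s.
  by rewrite in_itv /= => /gd [].
move: sh; rewrite in_itv /= => /andP[/ltW s0 /ltW sh].
have s0h : 0 <= s <= h by apply/andP.
pose k t : R := 'D_u f (x + s *: u + t *: v).
pose dk t : R := 'D_v ('D_u f) (x + s *: u + t *: v).
have kd t : 0 <= t <= h -> is_derive t 1 k (dk t).
  by move=> th; apply: is_derive_line; apply: dDf; exact: Ah.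
have [t th kt] : exists2 t, t \in `]0, h[%R &
    k h - k 0 = dk t * (h - 0).
  have Hc : {within `[0, h], continuous k}.
    apply: derivable_within_continuous => t.
    by rewrite in_itv /= => /kd [].
  have Hd t : t \in `]0, h[%R -> is_derive t 1 k (dk t).
    by rewrite in_itv /= => /andP[/ltW ? /ltW ?]; apply: kd; apply/andP.
  exact: @MVT R k dk 0 h h0 Hd Hc.
have {th}/andP[/ltW t0 /ltW th] : 0 < t < h by rewrite in_itv in th.
exists s, t; split=> //; first exact/andP.
have -> : f (x + h *: u + h *: v) - f (x + h *: u) - (f (x + h *: v) - f x)
  = g h - g 0 by rewrite /g !scale0r !addr0 (addrAC x).
rewrite gs -[in RHS](subr0 h) -/(dk t) -kt /dg /k scale0r addr0 subr0.
by rewrite (addrAC x).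
Qed.

Lemma dist_lt_half (a b d e : R) :
  `|a - d| < e / 2 -> `|b - d| < e / 2 -> `|a - b| <= e.
Proof.
move=> ad bd; rewrite (splitr e) -(subrKA d) (le_trans (ler_normD _ _))//.
by rewrite lerD// ltW// distrC.
Qed.

(** By [second_difference] for (u, v) and for (v, u), the two mixed derivatives
    take a common value at points arbitrarily close to [x]; conclude by
    continuity. *)
Lemma derive_schwarz (A : set V) f x u v : open A -> Ck 2 A f -> A x ->
  'D_u ('D_v f) x = 'D_v ('D_u f) x.
Proof.
move=> oA Cf Ax; apply/eqP; rewrite -subr_eq0 -normr_eq0; apply/eqP.
apply/eqP; rewrite eq_le normr_ge0 andbT; apply/ler_addgt0Pr => e e0; rewrite add0r.
have Cc a b : {for x, continuous ('D_a ('D_b f) : V -> R^o)}.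
  by case: Cf => _ /(_ b) [_ /(_ a)]; exact.
have e2 : 0 < e / 2 by rewrite divr_gt0.
pose D1 := 'D_u ('D_v f); pose D2 := 'D_v ('D_u f).
pose near_x y := [/\ A y, `|D1 x - D1 y| < e / 2 & `|D2 x - D2 y| < e / 2].
have N : nbhs x near_x.
  have N0 : nbhs x A := open_nbhs_nbhs (conj oA Ax).
  have N1 : \forall y \near x, `|D1 x - D1 y| < e / 2.
    exact: (cvgrPdist_lt _ _).1 (Cc u v) _ e2.
  have N2 : \forall y \near x, `|D2 x - D2 y| < e / 2.
    exact: (cvgrPdist_lt _ _).1 (Cc v u) _ e2.
  by apply: (filterS _ (filterI N0 (filterI N1 N2))) => y [? []].
have /nbhs_ballP[r r0 rN] := N.
(* so small that every point used by the second differences is in the ball *)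
pose h := r / (1 + `|u| + `|v|).
have d0 : 0 < 1 + `|u| + `|v| by rewrite ltr_pwDl// ltr_pwDl.
have h0 : 0 < h by rewrite divr_gt0.
have hb a b s t : `|a| + `|b| = `|u| + `|v| -> 0 <= s <= h -> 0 <= t <= h ->
    ball x r (x + s *: a + t *: b).
  move=> ab /andP[s0 sh] /andP[t0 th]; rewrite -ball_normE /= distrC -(addrA x) (addrC x) addrK.
  apply: (@le_lt_trans _ _ (h * (`|a| + `|b|))).
    rewrite (le_trans (ler_normD _ _))// !normrZ mulrDr !ger0_norm//.
    by rewrite lerD// ler_wpM2r.
  by rewrite ab /h mulrAC ltr_pdivrMr// ltr_pM2l// -addrA ltrDr.
have [s [t [sh th E1]]] : exists s t, [/\ 0 <= s <= h, 0 <= t <= h &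
    f (x + h *: u + h *: v) - f (x + h *: u) - (f (x + h *: v) - f x)
    = 'D_v ('D_u f) (x + s *: u + t *: v) * h * h].
  apply: second_difference Cf _ => // s t sh th.
  by have /rN [] := hb u v s t erefl sh th.
have [s' [t' [sh' th' E2]]] : exists s t, [/\ 0 <= s <= h, 0 <= t <= h &
    f (x + h *: v + h *: u) - f (x + h *: v) - (f (x + h *: u) - f x)
    = 'D_u ('D_v f) (x + s *: v + t *: u) * h * h].
  apply: second_difference Cf _ => // s' t' sh' th'.
  by have /rN [] := hb v u s' t' (addrC _ _) sh' th'.
have /rN [_ _ B1] := hb u v s t erefl sh th.
have /rN [_ B2 _] := hb v u s' t' (addrC _ _) sh' th'.
have E : D2 (x + s *: u + t *: v) = D1 (x + s' *: v + t' *: u).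
  have S : f (x + h *: u + h *: v) - f (x + h *: u) - (f (x + h *: v) - f x) =
      f (x + h *: v + h *: u) - f (x + h *: v) - (f (x + h *: u) - f x).
    rewrite (addrAC x (h *: u)).
    move: (f (_ + _ + _)) (f (x + h *: u)) (f (x + h *: v)) (f x) => a1 a2 a3 a4.
    by rewrite !opprB addrACA [RHS]addrACA; congr (_ + _); rewrite addrC.
  have hI := mulIf (lt0r_neq0 h0).
  exact: hI (hI _ _ (etrans (esym E1) (etrans S E2))).
rewrite E in B1; rewrite -[leLHS]/(`|D1 x - D2 x|).
exact: dist_lt_half B2 B1.
Qed.

End Schwarz.

Section Jacobi.
Context {R : realType} {n : nat}.

Lemma Ck_det (V : normedModType R) k (A : set V) (F : V -> 'M[R]_n) : open A ->
  (forall i j, Ck k A (fun x => F x i j : R^o)) ->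
  Ck k A (fun x => \det (F x) : R^o).
Proof.
move=> oA FC; rewrite /determinant; apply: Ck_sum => // s _.
apply: CkM => //; first exact: Ck_cst.
exact: Ck_prod.
Qed.

Lemma differentiable_det (A : 'M[R]_n) :
  differentiable (fun B : 'M[R]_n => \det B : R^o) A.
Proof.
have [|+ _] := @Ck_det 'M[R]_n 1 setT id openT _; last exact.
move=> i j; split=> [B _|v]; first exact: differentiable_coord.
have -> : 'D_v (fun B : 'M[R]_n => B i j : R^o) = fun=> (v i j : R^o).
  apply/funext => B.
  have d : derivable (id : 'M[R]_n -> 'M[R]_n) B v by [].
  have := derive_mx d; rewrite derive_id => /matrixP /(_ i j).
  by rewrite mxE => ->.
exact: Ck_cst.
Qed.

(** Along an elementary matrix the determinant is affine, by expansion along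
    row [i], whose cofactors do not involve that row. *)
Lemma derive_det_delta (A : 'M[R]_n) i j :
  'D_(delta_mx i j) (fun B : 'M[R]_n => \det B : R^o) A = cofactor A i j.
Proof.
have E (h : R) : \det (h *: delta_mx i j + A) = h * cofactor A i j + \det A.
  have C k : cofactor (h *: delta_mx i j + A) i k = cofactor A i k.
    congr (_ * \det _); apply/matrixP => a b; rewrite !mxE.
    by rewrite eq_sym (negbTE (neq_lift _ _)) mulr0 add0r.
  rewrite (expand_det_row _ i) (expand_det_row A i).
  under eq_bigr do rewrite C !mxE eqxx /= mulrDl.
  rewrite big_split /=; congr (_ + _).
  rewrite (bigD1 j)//= eqxx mulr1 big1 ?addr0// => k kj.
  by rewrite (negbTE kj) mulr0 mul0r.
rewrite /derive; apply/cvg_lim => //.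
apply: cvg_near_cst; near=> h.
have h0 : h != 0 by near: h; exact: nbhs_dnbhs_neq.
by rewrite /= E addrK /GRing.scale /= mulKf.
Unshelve. all: by end_near. Qed.

Lemma derive_detE (A B : 'M[R]_n) :
  'D_B (fun B : 'M[R]_n => \det B : R^o) A = \tr (B *m \adj A).
Proof.
have dA := differentiable_det A.
rewrite deriveE// [in LHS](matrix_sum_delta B) linear_sum /=.
apply: eq_bigr => i _; rewrite linear_sum mxE /=; apply: eq_bigr => j _.
by rewrite linearZ /= -deriveE// derive_det_delta [in RHS]mxE.
Qed.

Lemma differentiable_mx (V : normedModType R) m p (F : V -> 'M[R]_(m, p)) x :
  (forall i j, differentiable (fun y => F y i j : R^o) x) -> differentiable F x.
Proof.
move=> dF; have -> : F = \sum_(i < m) (fun y => \sum_(j < p) F y i j *: delta_mx i j).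
  by apply/funext => y; rewrite fct_sumE {1}(matrix_sum_delta (F y)).
apply: differentiable_sum => i.
have -> : (fun y => \sum_(j < p) F y i j *: delta_mx i j) =
  \sum_(j < p) (fun y => F y i j *: delta_mx i j :> 'M[R]_(m, p)).
  by apply/funext => y; rewrite fct_sumE.
by apply: differentiable_sum => j; exact: differentiableZl.
Qed.

(** Jacobi's formula; the inverse [G] of [F x] is an argument since the
    inverse Jacobian matrix is at hand as the Jacobian matrix of the inverse
    transition. *)
Lemma derive_det (V : normedModType R) (F : V -> 'M[R]_n) (G : 'M[R]_n) x u :
  (forall i j, differentiable (fun y => F y i j : R^o) x) -> F x *m G = 1%:M ->
  'D_u (fun y => \det (F y) : R^o) x =
  \det (F x) * \tr ((\matrix_(i, j) 'D_u (fun y => F y i j : R^o) x) *m G).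
Proof.
move=> dF FG; have dFx := differentiable_mx dF.
rewrite -[X in 'D_u X x]/((fun B : 'M[R]_n => \det B : R^o) \o F) derive_comp//;
  last exact: differentiable_det.
rewrite derive_detE -derive_mx; last exact: diff_derivable.
have -> : \adj (F x) = \det (F x) *: G.
  by rewrite -[LHS]mulmx1 -FG mulmxA mul_adj_mx mul_scalar_mx.
by rewrite -scalemxAr linearZ.
Qed.

End Jacobi.

(** * Transition maps and their Jacobians *)

Section Transitions.

Context {R : realType} {n : nat} (M : manifold R n).
Implicit Types (c : chart R n M) (x u v : 'rV[R]_n) (p : M).

Lemma cod_dom_cinv c x : cod c x -> dom c (cinv c x).
Proof. by move=> [p cp <-]; rewrite cmapK. Qed.

Lemma cinvK c x : cod c x -> cmap c (cinv c x) = x.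
Proof. by move=> [p cp <-]; rewrite cmapK. Qed.

Lemma cod_cmap c p : dom c p -> cod c (cmap c p).
Proof. by move=> cp; exists p. Qed.

Lemma overlapP c c' x : overlap c c' x <-> cod c x /\ dom c' (cinv c x).
Proof.
split=> [[p [cp c'p] <-]|[cx c'x]].
  by split; [exact: cod_cmap|rewrite cmapK].
exists (cinv c x); last exact: cinvK.
by split=> //; exact: cod_dom_cinv.
Qed.

Lemma open_chart_preimage c (U : set M) : open U ->
  open (cod c `&` cinv c @^-1` U).
Proof.
move=> oU; rewrite openE => x [cx Ux].
apply: filterI; first exact: open_nbhs_nbhs (conj (@cod_open _ _ _ c) cx).
apply: (@cinv_continuous _ _ _ c x cx).
exact: open_nbhs_nbhs.
Qed.

Lemma overlap_open c c' : open (overlap c c').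
Proof.
have -> : overlap c c' = cod c `&` cinv c @^-1` dom c'.
  by apply/seteqP; split=> x /=; [move=> /overlapP|move=> ?; apply/overlapP].
exact/open_chart_preimage/dom_open.
Qed.

Lemma overlap_cod c c' x : overlap c c' x -> cod c x.
Proof. by move=> /overlapP []. Qed.

Lemma overlap_refl c x : cod c x -> overlap c c x.
Proof. by move=> cx; apply/overlapP; split=> //; exact: cod_dom_cinv. Qed.

Lemma cinv_transition c c' x : overlap c c' x ->
  cinv c' (transition c c' x) = cinv c x.
Proof. by move=> /overlapP[cx c'x]; rewrite /transition /= cmapK. Qed.

Lemma overlap_transition c c' c'' x : overlap c c' x -> overlap c c'' x ->
  overlap c' c'' (transition c c' x).
Proof.
move=> o /overlapP[cx c''x]; apply/overlapP; rewrite cinv_transition//.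
by split=> //; case/overlapP: o => _; exact: cod_cmap.
Qed.

Lemma overlap_sym c c' x : overlap c c' x -> overlap c' c (transition c c' x).
Proof.
by move=> o; apply: overlap_transition => //; exact/overlap_refl/(overlap_cod o).
Qed.

Lemma transition_cocycle c c' c'' x : overlap c c' x ->
  transition c' c'' (transition c c' x) = transition c c'' x.
Proof. by move=> o; rewrite -[LHS]/(cmap c'' _) cinv_transition. Qed.

Lemma transition_refl c x : cod c x -> transition c c x = x.
Proof. exact: cinvK. Qed.

Lemma smooth_transition c c' : atlas c -> atlas c' ->
  smooth (overlap c c') (transition c c').
Proof. by move=> ac ac'; have [] := atlas_compatible ac ac'. Qed.

Lemma differentiable_transition c c' x : atlas c -> atlas c' -> overlap c c' x ->
  differentiable (transition c c') x.
Proof. by move=> ac ac' o; have [+ _] := smooth_transition ac ac' 1; exact. Qed.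

Lemma near_overlap c c' x : overlap c c' x -> \forall y \near x, overlap c c' y.
Proof. by move=> o; exact: open_nbhs_nbhs (conj (@overlap_open c c') o). Qed.

Lemma derive_transition c c' c'' x u :
  atlas c -> atlas c' -> atlas c'' -> overlap c c' x -> overlap c c'' x ->
  'D_u (transition c c'') x =
  'D_('D_u (transition c c') x) (transition c' c'') (transition c c' x).
Proof.
move=> ac ac' ac'' o o'; rewrite -derive_comp.
- apply: near_eq_derive; apply: filterS (near_overlap o) => y oy.
  by rewrite [RHS]/= transition_cocycle.
- exact: differentiable_transition.
- by apply: differentiable_transition => //; exact: overlap_transition.
Qed.

Lemma derive_transition_refl c x u : cod c x -> 'D_u (transition c c) x = u.
Proof.
move=> cx; rewrite (@near_eq_derive _ _ _ _ id); first exact: derive_id.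
apply: filterS (open_nbhs_nbhs (conj (@cod_open _ _ _ c) cx)) => y.
exact: transition_refl.
Qed.

(** Vectors are rows, so this matrix acts on the right and the chain rule
    multiplies Jacobians from left to right. *)
Definition jac c c' x : 'M[R]_n := jacobian (transition c c') x.

Lemma derive_jac c c' x u : atlas c -> atlas c' -> overlap c c' x ->
  'D_u (transition c c') x = u *m jac c c' x.
Proof. by move=> ac ac' o; exact/deriveEjacobian/differentiable_transition. Qed.

Lemma jacE c c' x i j : atlas c -> atlas c' -> overlap c c' x ->
  jac c c' x i j = 'D_'e_i (transition c c') x 0 j.
Proof. by move=> ac ac' o; rewrite derive_jac// -rowE [RHS]mxE. Qed.

Lemma jac_cocycle c c' c'' x :
  atlas c -> atlas c' -> atlas c'' -> overlap c c' x -> overlap c c'' x ->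
  jac c c'' x = jac c c' x *m jac c' c'' (transition c c' x).
Proof.
move=> ac ac' ac'' o o'; apply/row_matrixP => i.
have o2 := overlap_transition o o'.
rewrite rowE [RHS]rowE.
have := derive_transition 'e_i ac ac' ac'' o o'.
rewrite (derive_jac 'e_i ac ac'' o') (derive_jac _ ac' ac'' o2).
by rewrite (derive_jac 'e_i ac ac' o) mulmxA.
Qed.

Lemma jac_refl c x : atlas c -> cod c x -> jac c c x = 1%:M.
Proof.
move=> ac cx; apply/row_matrixP => i; rewrite rowE [RHS]rowE mulmx1.
have := derive_jac 'e_i ac ac (overlap_refl cx).
by rewrite derive_transition_refl.
Qed.

Lemma jac_inv c c' x : atlas c -> atlas c' -> overlap c c' x ->
  jac c c' x *m jac c' c (transition c c' x) = 1%:M.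
Proof.
move=> ac ac' o; rewrite -jac_cocycle//; last exact/overlap_refl/(overlap_cod o).
exact/jac_refl/(overlap_cod o).
Qed.

Lemma det_jac_neq0 c c' x : atlas c -> atlas c' -> overlap c c' x ->
  \det (jac c c' x) != 0.
Proof.
move=> ac ac' o; apply/eqP => d0; have /eqP := congr1 determinant (jac_inv ac ac' o).
by rewrite det_mulmx [X in X * _]d0 mul0r det1 eq_sym oner_eq0.
Qed.

Lemma smooth_jac c c' i j : atlas c -> atlas c' ->
  smooth (overlap c c') (fun x => jac c c' x i j : R^o).
Proof.
move=> ac ac' k; have oo := @overlap_open c c'.
have [_ /(_ 'e_i) /(Ck_rowP _ _ oo) /(_ j)] := smooth_transition ac ac' k.+1.
by apply: Ck_ext => // x o; rewrite jacE.
Qed.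

Lemma smooth_det_jac c c' : atlas c -> atlas c' ->
  smooth (overlap c c') (fun x => \det (jac c c' x) : R^o).
Proof.
move=> ac ac' k; apply: Ck_det => [|i j]; first exact: overlap_open.
exact: smooth_jac.
Qed.

End Transitions.

(** * Extension by zero; torsion in components *)

Section ExtensionByZero.
Context {R : realType} {n : nat} (M : manifold R n).
Implicit Types (c : chart R n M) (x u v : 'rV[R]_n) (p : M).

(** A compact set [K] around the support is recorded because its image in the
    manifold is compact, hence closed: this allows extension by zero. *)
Lemma chart_bump c p (U : set M) : open U -> U p -> dom c p ->
  exists b : 'rV[R]_n -> R^o, exists K : set 'rV[R]_n,
  [/\ smooth setT b, forall x, 0 <= b x, 0 < b (cmap c p), compact K &
      forall x, (b x != 0 -> K x) /\ (K x -> cod c x /\ U (cinv c x))].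
Proof.
move=> oU Up cp; have oV := open_chart_preimage (c := c) oU.
have Vp : (cod c `&` cinv c @^-1` U) (cmap c p).
  by split; [exact: cod_cmap|rewrite /= cmapK].
have /nbhs_ballP[r /= r0 rV] := open_nbhs_nbhs (conj oV Vp).
have r2 : 0 < r / 2 by rewrite divr_gt0.
have [b [bs b0 bp bK]] := smooth_bump (cmap c p) r2.
exists b, (closed_ball (cmap c p) (r / 2)); split=> //.
  apply: bounded_closed_compact; last exact: closed_ball_closed.
  exists (`|cmap c p| + r / 2); split; first exact: num_real.
  move=> z zr y; rewrite closed_ballE//= /closed_ball_ /= => yr.
  rewrite (le_trans _ (ltW zr))// -(subrKC (cmap c p) y) addrC.
  by rewrite (le_trans (ler_normD _ _))// addrC lerD// distrC.
move=> x; split=> [/bK|]; first exact: subset_closed_ball.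
rewrite closed_ballE//= /closed_ball_ /= => xr; apply: rV.
by rewrite -ball_normE /= (le_lt_trans xr)// ltr_pdivrMr// ltr_pMr// ltr1n.
Qed.

Lemma patch_in (W : zmodType) (A : set 'rV[R]_n) (F : 'rV[R]_n -> W) x : A x ->
  patch (fun=> 0) A F x = F x.
Proof. by move=> Ax; rewrite /patch mem_set. Qed.

Lemma patch_out (W : zmodType) (A : set 'rV[R]_n) (F : 'rV[R]_n -> W) x : ~ A x ->
  patch (fun=> 0) A F x = 0.
Proof. by move=> Ax; rewrite /patch memNset. Qed.

(** Extension by zero: a point outside the domain of [c0] has a neighbourhood
    which avoids the image of [K], a compact and so closed subset of a Hausdorff
    space; there the function vanishes identically. *)
Lemma smooth_patch (W : normedModType R) c0 c (K : set 'rV[R]_n)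
    (b : 'rV[R]_n -> R^o) (F : 'rV[R]_n -> W) : atlas c0 -> atlas c ->
  compact K -> (forall x, (b x != 0 -> K x) /\ (K x -> cod c0 x)) ->
  smooth setT b -> smooth (overlap c c0) F ->
  smooth (cod c) (patch (fun=> 0) (overlap c c0)
    (fun x => b (transition c c0 x) *: F x)).
Proof.
move=> a0 ac cK bK bs Fs k; apply: Ck_local => x cx.
have oo := @overlap_open _ _ M c c0.
have [ov|no] := pselect (overlap c c0 x).
  exists (overlap c c0); first exact: near_overlap.
  have := @Ck_scale R 'rV[R]_n W k _ _ _ oo
    (Ck_comp (row_coordinates n) oo (B := setT) (fun _ _ => I)
      (smooth_transition ac a0 k) (bs k)) (Fs k).
  by apply: Ck_ext => // y oy; rewrite patch_in.
(* the points whose image avoids the compact set containing the support *)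
pose N := cod c `&` cinv c @^-1` (~` (cinv c0 @` K)).
have oN : open N.
  apply/open_chart_preimage/closed_openC.
  apply: compact_closed; first exact: manifold_hausdorff.
  apply: continuous_compact => //; apply: continuous_in_subspaceT => y.
  rewrite inE => Ky; apply: cinv_continuous; exact: (bK y).2.
exists N.
  apply: open_nbhs_nbhs; split=> //; split=> // -[y Ky E]; apply: no.
  by apply/overlapP; split=> //; rewrite -E; exact/cod_dom_cinv/(bK y).2.
apply: Ck_ext (Ck_cst _ _ 0) => // y [cy Ny]; rewrite /patch.
case: ifPn => // /set_mem oy; suff -> : b (transition c c0 y) = 0 by rewrite scale0r.
apply/eqP/negPn/negP => /((bK _).1) Ky; apply: Ny.
by exists (transition c c0 y) => //; exact: cinv_transition.
Qed.

(** The constant field [u] of the chart [c], multiplied by a bump function; the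
    factor [a] is the value of the bump function at [x]. *)
Lemma vector_field_extension c x u : atlas c -> cod c x ->
  exists2 a : R, a != 0 & exists X : vector_field M, X c x = a *: u.
Proof.
move=> ac cx; have [|//||b [K [bs b0 bp cK bK]]] := @chart_bump c (cinv c x) setT.
- exact: openT.
- exact: cod_dom_cinv.
rewrite cinvK// in bp.
pose X c' : 'rV[R]_n -> 'rV[R]_n := patch (fun=> 0) (overlap c' c)
  (fun y => b (transition c' c y) *: 'D_u (transition c c') (transition c' c y)).
have Xs c' : atlas c' -> smooth (cod c') (X c').
  move=> ac'; apply: (smooth_patch ac ac' cK) => //.
    by move=> y; split; [exact: (bK y).1|case/((bK y).2)].
  move=> k; apply: (@Ck_comp R _ _ _ (row_coordinates n) k _ (overlap c c')
    (transition c' c) ('D_u (transition c c')) (@overlap_open _ _ M _ _)).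
  - by move=> y; exact: overlap_sym.
  - exact: smooth_transition.
  - by have [_] := smooth_transition ac ac' k.+1; exact.
have Xt c' c'' : atlas c' -> atlas c'' -> forall y, overlap c' c'' y ->
    X c'' (transition c' c'' y) = 'D_(X c' y) (transition c' c'') y.
  move=> a' a'' y o.
  have [ovy|noy] := pselect (overlap c' c y); last first.
    rewrite /X [in RHS]patch_out// derive0 patch_out// => o2; apply: noy.
    have := overlap_transition (overlap_sym o) o2.
    by rewrite transition_cocycle// transition_refl//; exact: overlap_cod o.
  rewrite /X !patch_in//; last exact: overlap_transition.
  have oz := overlap_sym ovy.
  have oz' : overlap c c'' (transition c' c y) by exact: overlap_transition.
  have Ez : transition c'' c (transition c' c'' y) = transition c' c y.
    exact: transition_cocycle.
  have Ey : transition c c' (transition c' c y) = y.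
    by rewrite transition_cocycle// transition_refl//; exact: overlap_cod o.
  have := derive_transition u ac a' a'' oz oz'; rewrite Ez Ey => ->.
  by rewrite derive_scaler//; exact: differentiable_transition.
exists (b x); first exact: lt0r_neq0.
have oc := overlap_refl cx; exists (VectorField Xs Xt).
by rewrite /= /X patch_in// transition_refl// derive_transition_refl.
Qed.

Lemma GammaZl (G : components) x a u v :
  Gamma G x (a *: u) v = a *: Gamma G x u v :> 'rV[R]_n.
Proof.
apply/rowP => k; rewrite !mxE mulr_sumr; apply: eq_bigr => i _.
by rewrite mulr_sumr; apply: eq_bigr => j _; rewrite !mxE; ring.
Qed.

Lemma GammaZr (G : components) x a u v :
  Gamma G x u (a *: v) = a *: Gamma G x u v :> 'rV[R]_n.
Proof.
apply/rowP => k; rewrite !mxE mulr_sumr; apply: eq_bigr => i _.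
by rewrite mulr_sumr; apply: eq_bigr => j _; rewrite !mxE; ring.
Qed.

Lemma Gamma_delta (G : components) x i j k : Gamma G x 'e_i 'e_j 0 k = G x k i j :> R.
Proof.
rewrite mxE (bigD1 i)//= (bigD1 j)//= !mxE !eqxx !mulr1.
rewrite !big1 ?addr0//= => a ai; last by rewrite !mxE (negbTE ai) mulr0.
by rewrite big1// => b _; rewrite !mxE (negbTE ai) mulr0 mul0r.
Qed.

(** Evaluate the condition on global fields extending multiples of two
    coordinate directions. *)
Lemma torsion_free_sym (nabla : affine_connection M) c x k i j :
  torsion_free nabla -> atlas c -> cod c x -> nabla c x k i j = nabla c x k j i.
Proof.
move=> tf ac cx.
have [a a0 [X Xx]] := vector_field_extension 'e_i ac cx.
have [b b0 [Y Yx]] := vector_field_extension 'e_j ac cx.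
have := tf X Y c ac x cx; rewrite /cov /lie_bracket !Xx !Yx.
rewrite opprD addrACA => /(canRL (addKr _)); rewrite addNr.
rewrite !GammaZl !GammaZr !scalerA (mulrC b) -scalerBr => /eqP.
rewrite scaler_eq0 mulf_eq0 (negbTE a0) (negbTE b0) /= subr_eq0 => /eqP/rowP/(_ k).
by rewrite !Gamma_delta.
Qed.

End ExtensionByZero.

(** * Existence of a positive density *)

Section Densities.
Context {R : realType} {n : nat} (M : manifold R n).
Implicit Types (c : chart R n M) (x u v : 'rV[R]_n) (p : M).

(** Nonnegative smooth densities of weight two.  Their transformation law is
    linear, so that they can be added; the even weight keeps it polynomial in the
    Jacobian. *)
Record density := Density {
  dens :> chart R n M -> 'rV[R]_n -> R^o ;
  dens_smooth : forall c, atlas c -> smooth (cod c) (dens c) ;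
  dens_ge0 : forall c x, atlas c -> cod c x -> 0 <= dens c x ;
  dens_transform : forall c c', atlas c -> atlas c' ->
    forall x, overlap c c' x ->
      dens c x = dens c' (transition c c' x) * \det (jac c c' x) ^+ 2
}.

Definition density_pos (d : density) p :=
  forall c, atlas c -> dom c p -> 0 < d c (cmap c p).

Definition supported (d : density) (U : set M) :=
  forall c x, atlas c -> cod c x -> ~ U (cinv c x) -> d c x = 0.

(** Positivity in one chart around [p] implies positivity in all of them, the
    Jacobian being invertible. *)
Lemma density_posP (d : density) p c : atlas c -> dom c p ->
  density_pos d p <-> 0 < d c (cmap c p).
Proof.
move=> ac cp; split=> [|dp c' ac' c'p]; first exact.
have o : overlap c c' (cmap c p) by apply/overlapP; rewrite cmapK//; split=> //; exact: cod_cmap.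
have := dens_transform d ac ac' o; rewrite /transition /= cmapK// => E.
have : 0 <= d c' (cmap c' p) by apply: dens_ge0 => //; exact: cod_cmap.
rewrite le_eqVlt => /orP[/eqP d0|//].
by move: dp; rewrite E -d0 mul0r ltxx.
Qed.

Lemma density_pos_open d : open (density_pos d).
Proof.
rewrite openE => p dp; have [c ac cp] := atlas_cover p.
have dc : {for p, continuous (d c \o cmap c)}.
  apply: continuous_comp; first exact: cmap_continuous.
  exact: (Ck_continuous (dens_smooth d ac 0%N) (cod_cmap cp)).
have dp0 : 0 < (d c \o cmap c) p by exact: dp.
have Nd : \forall q \near p, 0 < (d c \o cmap c) q by exact: (cvgr_gt _ dc).
have Nc : nbhs p (dom c) := open_nbhs_nbhs (conj (dom_open c) cp).
by apply: (filterS _ (filterI Nd Nc)) => q [dq cq]; exact/(density_posP d ac cq).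
Qed.

Lemma density0 : exists d : density, forall c x, d c x = 0.
Proof.
have s c : atlas c -> smooth (cod c) ((fun=> 0) : 'rV[R]_n -> R^o).
  by move=> _ k; exact: Ck_cst.
have t c c' : atlas c -> atlas c' -> forall x, overlap c c' x ->
  0 = 0 * \det (jac c c' x) ^+ 2 by move=> *; rewrite mul0r.
by exists (@Density (fun _ _ => 0) s (fun _ _ _ _ => lexx 0) t).
Qed.

Lemma densityD (d d' : density) :
  exists e : density, forall c x, e c x = d c x + d' c x.
Proof.
have s c : atlas c -> smooth (cod c) (fun x => d c x + d' c x).
  by move=> ac k; apply: CkD; [exact: cod_open|exact: dens_smooth..].
have p c x : atlas c -> cod c x -> 0 <= d c x + d' c x.
  by move=> ac cx; apply: addr_ge0; exact: dens_ge0.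
have t c c' : atlas c -> atlas c' -> forall x, overlap c c' x ->
    d c x + d' c x = (d c' (transition c c' x) + d' c' (transition c c' x))
      * \det (jac c c' x) ^+ 2.
  move=> ac ac' x o.
  by rewrite (dens_transform d ac ac' o) (dens_transform d' ac ac' o) mulrDl.
by exists (@Density (fun c x => d c x + d' c x) s p t).
Qed.

Lemma bump_density p (U : set M) : open U -> U p ->
  exists2 d : density, density_pos d p & supported d U.
Proof.
move=> oU Up; have [c0 a0 c0p] := atlas_cover p.
have [b [K [bs b0 bp cK bK]]] := chart_bump oU Up c0p.
pose d c : 'rV[R]_n -> R^o := patch (fun=> 0) (overlap c c0)
  (fun y => b (transition c c0 y) *: (\det (jac c c0 y) ^+ 2 : R^o)).
have dE c x : overlap c c0 x ->
    d c x = b (transition c c0 x) * \det (jac c c0 x) ^+ 2 by exact: patch_in.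
have d_out c x : ~ overlap c c0 x -> d c x = 0 by exact: patch_out.
have ds c : atlas c -> smooth (cod c) (d c).
  move=> ac; apply: (smooth_patch a0 ac cK) => //.
    by move=> y; split; [exact: (bK y).1|case/((bK y).2)].
  by move=> k; apply: CkM; [exact: overlap_open|exact: smooth_det_jac..].
have d0 c x : atlas c -> cod c x -> 0 <= d c x.
  move=> ac cx; have [ov|nov] := pselect (overlap c c0 x); last by rewrite d_out.
  by rewrite dE// mulr_ge0// sqr_ge0.
have dt c c' : atlas c -> atlas c' -> forall x, overlap c c' x ->
    d c x = d c' (transition c c' x) * \det (jac c c' x) ^+ 2.
  move=> ac ac' x o; have [ov|nov] := pselect (overlap c c0 x); last first.
    rewrite (d_out c x nov) d_out ?mul0r// => o2; apply: nov.
    have := overlap_transition (overlap_sym o) o2.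
    by rewrite transition_cocycle// transition_refl//; exact: overlap_cod o.
  have o2 := overlap_transition o ov.
  rewrite (dE c x ov) (dE c' _ o2) (transition_cocycle c0 o).
  by rewrite (jac_cocycle ac ac' a0 o ov) det_mulmx exprMn (mulrC (_ ^+ 2)) mulrA.
exists (Density ds d0 dt).
  apply/(density_posP _ a0 c0p); have c0x := cod_cmap c0p.
  have o := overlap_refl c0x.
  rewrite /= (dE _ _ o) transition_refl// mulr_gt0//.
  by rewrite exprn_even_gt0//= (det_jac_neq0 a0 a0 o).
move=> c x ac cx nUx; rewrite /=.
have [ov|nov] := pselect (overlap c c0 x); last exact: d_out.
rewrite (dE c x ov); suff -> : b (transition c c0 x) = 0 by rewrite mul0r.
apply/eqP/negPn/negP => /((bK _).1) /((bK _).2) [_].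
by rewrite cinv_transition.
Qed.

Lemma density_sum I (s : seq I) (d : I -> density) :
  exists e : density, forall c x, e c x = \sum_(i <- s) d i c x.
Proof.
elim: s => [|i s [e eE]].
  by have [e eE] := density0; exists e => c x; rewrite eE big_nil.
by have [f fE] := densityD (d i) e; exists f => c x; rewrite fE big_cons eE.
Qed.

(** Compactness by open covers is stated for pointed spaces: a nonempty set
    provides the point, and the empty set is covered by the empty family. *)
Lemma finite_subcover (T : topologicalType) (K : set T) (I : choiceType)
    (D : set I) (f : I -> set T) : compact K ->
  (forall i, D i -> open (f i)) -> K `<=` cover D f -> finite_subset_cover D f K.
Proof.
move=> cK fo Kf; have [[p0 _]|K0] := pselect (K !=set0); last first.
  by exists finmap.fset0 => [i|p Kp]; [rewrite finmap.in_fset0|case: K0; exists p].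
pose T' : ptopologicalType := HB.pack (T : Type) T (isPointed.Build T p0).
have : @compact T' K := cK.
by rewrite compact_cover; apply.
Qed.

(** A finite sum of bump densities, by compactness. *)
Lemma compact_density (K U : set M) : compact K -> open U -> K `<=` U ->
  exists2 d : density, forall p, K p -> density_pos d p & supported d U.
Proof.
move=> cK oU KU; have [d0 d0E] := density0.
have /choice[d dP] p : exists d : density,
    K p -> density_pos d p /\ supported d U.
  have [Kp|nKp] := pselect (K p); last by exists d0.
  by have [d dp dU] := bump_density oU (KU p Kp); exists d.
have [|p Kp|s sK Ks] := finite_subcover cK (D := K) (f := fun p => density_pos (d p)).
- by move=> p _; exact: density_pos_open.
- by exists p => //; have [] := dP p Kp.
have [e eE] := density_sum (finmap.enum_fset s) d.
exists e => [p Kp c ac cp|c x ac cx nUx].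
  rewrite eE; have [q /= qs dq] := Ks p Kp.
  have ge0 i : 0 <= d i c (cmap c p) by apply: dens_ge0 => //; exact: cod_cmap.
  rewrite (big_rem q)//= ltr_pwDl//; first exact: dq.
  by apply: sumr_ge0.
rewrite eE big_seq big1// => q qs; have Kq : K q by have := sK q qs; rewrite inE.
by have [_] := dP q Kq; exact.
Qed.

(** Near each point the sum over [V] is a finite sum over the members of [V]
    which meet a fixed neighbourhood. *)
Lemma locally_finite_density (V : set (set M)) (d : set M -> density) :
  locally_finite V -> (forall A, V A -> supported (d A) A) ->
  exists e : density, forall A p, V A -> density_pos (d A) p -> density_pos e p.
Proof.
move=> lV dV.
pose e c x : R^o := \sum_(A \in V) d A c x.
have eN p : exists s : seq (set M), exists N, [/\ nbhs p N,
    forall c x, atlas c -> cod c x -> N (cinv c x) -> e c x = \sum_(A <- s) d A c x &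
    forall A, V A -> A p -> A \in s].
  have [N Np fN] := lV p.
  exists (finmap.enum_fset (fset_set [set A | V A /\ A `&` N !=set0])), N; split=> //.
    move=> c x ac cx Nx; rewrite -fsbig_finite//.
    apply/esym/fsbig_widen => [A []//|A [VA nA]] /=.
    apply: dV => // Ax; apply: nA; split=> //; by exists (cinv c x).
  move=> A VA Ap; rewrite in_fset_set// inE; split=> //; exists p; split=> //.
  exact: nbhs_singleton.
have es c : atlas c -> smooth (cod c) (e c).
  move=> ac k; apply: Ck_local => x cx.
  have [s [N [Np eE _]]] := eN (cinv c x).
  have oO := open_chart_preimage (c := c) (open_interior N).
  exists (cod c `&` cinv c @^-1` N^°).
    by apply: open_nbhs_nbhs; split=> //; split=> //; exact: nbhs_interior Np.
  have Cs : Ck k (cod c `&` cinv c @^-1` N^°) (fun x => \sum_(A <- s) d A c x).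
    apply: Ck_sum => // A _; apply: (Ck_sub (A := cod c)); first by move=> y [].
    exact: dens_smooth.
  apply: Ck_ext Cs => // y [cy Ny]; rewrite (eE c y)//; exact: interior_subset Ny.
have e0 c x : atlas c -> cod c x -> 0 <= e c x.
  move=> ac cx; have [s [N [/nbhs_singleton Np eE _]]] := eN (cinv c x).
  by rewrite (eE c x ac cx Np); apply: sumr_ge0 => A _; exact: dens_ge0.
have et c c' : atlas c -> atlas c' -> forall x, overlap c c' x ->
    e c x = e c' (transition c c' x) * \det (jac c c' x) ^+ 2.
  move=> ac ac' x o; have [s [N [/nbhs_singleton Np eE _]]] := eN (cinv c x).
  have o2 := overlap_sym o.
  rewrite (eE c x ac (overlap_cod o) Np) (eE c' _ ac' (overlap_cod o2)).
    by rewrite mulr_suml; apply: eq_bigr => A _; exact: dens_transform.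
  by rewrite cinv_transition.
exists (Density es e0 et) => A p VA dp c ac cp /=.
have cx := cod_cmap cp.
have [s [N [/nbhs_singleton Np eE sA]]] := eN p.
rewrite (eE c _ ac cx) ?cmapK//.
have As : A \in s.
  apply: sA => //; apply: contrapT => nAp; have := dp c ac cp.
  by rewrite (dV A VA)// ?ltxx// cmapK.
rewrite (big_rem A)//= ltr_pwDl//; first exact: dp.
by apply: sumr_ge0 => B _; exact: dens_ge0.
Qed.

Lemma compact_nbhs p (U : set M) : open U -> U p ->
  exists N K : set M, [/\ open N, N p, N `<=` K, compact K & K `<=` U].
Proof.
move=> oU Up; have [c ac cp] := atlas_cover p.
have [b [K [bs b0 bp cK bK]]] := chart_bump oU Up cp.
exists [set q | dom c q /\ 0 < b (cmap c q)], (cinv c @` K); split=> //.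
- rewrite openE => q [cq bq].
  have bc : {for q, continuous (b \o cmap c)}.
    by apply: continuous_comp; [exact: cmap_continuous|exact: (Ck_continuous (bs 0%N) I)].
  have Nb : \forall r \near q, 0 < (b \o cmap c) r by exact: (cvgr_gt _ bc).
  exact: filterI (open_nbhs_nbhs (conj (dom_open c) cq)) Nb.
- move=> q [cq bq]; exists (cmap c q); last exact: cmapK.
  exact/(bK _).1/lt0r_neq0.
- apply: continuous_compact => //; apply: continuous_in_subspaceT => y.
  rewrite inE => Ky; apply: cinv_continuous; exact: ((bK y).2 Ky).1.
- by move=> q [y Ky <-]; exact: ((bK y).2 Ky).2.
Qed.

(** For a locally finite family the closure of the union is the union of the
    closures. *)
Lemma closure_locally_finite_sub (T : topologicalType) (W : set (set T)) (A : set T) :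
  locally_finite W ->
  closure (\bigcup_(B in [set B | W B /\ closure B `<=` A]) B) `<=` A.
Proof.
move=> lW p cp; have [N Np fN] := lW p.
pose F := [set B | (W B /\ B `&` N !=set0) /\ closure B `<=` A].
have fF : finite_set F by apply: sub_finite_set fN => B [].
have cZ : closed (\bigcup_(B in F) closure B).
  by apply: closed_bigcup => // B _; exact: closed_closure.
apply: contrapT => nAp.
have nZ : (~` \bigcup_(B in F) closure B) p by move=> [B [_ BA] /BA].
have := cp _ (filterI Np (open_nbhs_nbhs (conj (closed_openC cZ) nZ))).
move=> [q [[B [WB BA] Bq] [Nq nZq]]]; apply: nZq; exists B; last exact: subset_closure.
by split=> //; split=> //; exists q.
Qed.

(** Paracompactness is used twice.  The first locally finite cover [V] consists
    of relatively compact sets.  The second, [W], consists of sets whose closure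
    lies in a member of [V].  For [A] in [V], the closure [C A] of the union of
    the members of [W] with closure in [A] is then a compact subset of [A], and
    these compact sets cover the manifold. *)
Lemma positive_density :
  exists d : density, forall c x, atlas c -> cod c x -> 0 < d c x.
Proof.
have hM := @manifold_hausdorff _ _ M.
pose U1 := [set N : set M | open N /\ exists2 K, compact K & N `<=` K].
have [A []//||V [oV cV VU1 lV]] := @manifold_paracompact _ _ M U1.
  apply/seteqP; split=> // p _.
  have [N [K [oN Np NK cK _]]] := @compact_nbhs p setT openT I.
  by exists N => //; split=> //; exists K.
pose U2 := [set N : set M | open N /\ exists2 A, V A & closure N `<=` A].
have [A []//||W [oW cW WU2 lW]] := @manifold_paracompact _ _ M U2.
  apply/seteqP; split=> // p _.
  have : (\bigcup_(A in V) A) p by rewrite cV.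
  move=> [A VA Ap]; have [N [K [oN Np NK cK KA]]] := compact_nbhs (oV A VA) Ap.
  exists N => //; split=> //; exists A => // q /(closure_subset NK).
  by rewrite -(closure_id K).1; [exact: KA|exact: compact_closed].
pose C (A : set M) := closure (\bigcup_(B in [set B | W B /\ closure B `<=` A]) B).
have CA A : C A `<=` A by exact: closure_locally_finite_sub.
have [d0 _] := density0.
have /choice[d dP] A : exists d : density, V A ->
    (forall p, C A p -> density_pos d p) /\ supported d A.
  have [VA|nVA] := pselect (V A); last by exists d0.
  have [B [oB [K cK BK]] AB] := VU1 A VA.
  have cC : compact (C A).
    apply: (subclosed_compact _ cK); first exact: closed_closure.
    by move=> p /CA /AB /BK.
  by have [d dC dA] := compact_density cC (oV A VA) (@CA A); exists d.
have [e eP] := locally_finite_density lV (fun A VA => (dP A VA).2).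
exists e => c x ac cx; have cp := cod_dom_cinv cx.
rewrite -(cinvK cx); move: {x cx} (cinv c x) cp => p cp.
have : (\bigcup_(B in W) B) p by rewrite cW.
move=> [B WB Bp]; have [N [oN [A VA NA]] BN] := WU2 B WB.
apply: (eP A p VA _ c ac cp); apply: (dP A VA).1; apply: subset_closure.
by exists B => //; split=> //; exact: subset_trans (closure_subset BN) NA.
Qed.

End Densities.

(** * Christoffel symbols, Ricci tensor and projective changes *)

Section Components.
Context {R : realType} {n : nat}.
Implicit Types (G : @components R n) (x u v : 'rV[R]_n) (w : 'rV[R]_n -> 'I_n -> R).

(** The matrix of v |-> Gamma (u, v), acting on rows from the right. *)
Definition conn_form G x u : 'M[R]_n := \matrix_(j, k) \sum_i G x k i j * u 0 i.

Lemma mul_conn_form G x u v : v *m conn_form G x u = Gamma G x u v.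
Proof.
apply/rowP => k; rewrite !mxE exchange_big /=; apply: eq_bigr => j _.
by rewrite mxE mulr_sumr; apply: eq_bigr => i _; rewrite mulrC.
Qed.

Lemma Gamma_sym G x u v : (forall k i j, G x k i j = G x k j i) ->
  Gamma G x u v = Gamma G x v u.
Proof.
move=> sG; apply/rowP => k; rewrite !mxE exchange_big /=.
by do 2![apply: eq_bigr => ? _]; rewrite sG mulrAC.
Qed.

Lemma Ck_Gamma k (A : set 'rV[R]_n) G u v : open A ->
  (forall a i j, Ck k A (fun x => G x a i j : R^o)) ->
  Ck k A (fun x => Gamma G x u v).
Proof.
move=> oA CG; apply/(Ck_rowP _ _ oA) => a.
have : Ck k A (fun x => \sum_i \sum_j G x a i j * u 0 i * v 0 j : R^o).
  apply: Ck_sum => // i _; apply: Ck_sum => // j _.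
  by do 2?[apply: CkM => //; last exact: Ck_cst].
by apply: Ck_ext => // x _; rewrite mxE.
Qed.

Lemma Ck_tr_conn_form k (A : set 'rV[R]_n) G u : open A ->
  (forall a i j, Ck k A (fun x => G x a i j : R^o)) ->
  Ck k A (fun x => \tr (conn_form G x u) : R^o).
Proof.
move=> oA CG.
have : Ck k A (fun x => \sum_j \sum_i G x j i j * u 0 i : R^o).
  apply: Ck_sum => // i _; apply: Ck_sum => // j _.
  by apply: CkM => //; exact: Ck_cst.
by apply: Ck_ext => // x _; apply: eq_bigr => j _; rewrite mxE.
Qed.

Lemma derive_cst_fun (V W : normedModType R) (a : W) (x v : V) : 'D_v (fun=> a) x = 0.
Proof. exact: derive_cst. Qed.

(** On fields with constant components the covariant derivative is given by the
    Christoffel symbols alone, and the bracket vanishes. *)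
Lemma curvature_atE G x u (w : 'rV[R]_n) v : curvature_at G x u w v =
  'D_u (fun y => Gamma G y w v) x + Gamma G x u (Gamma G x w v)
  - ('D_w (fun y => Gamma G y u v) x + Gamma G x w (Gamma G x u v)).
Proof.
have covE a b : cov G (fun=> a) (fun=> b) = fun y => Gamma G y a b.
  by apply/funext => y; rewrite /cov derive_cst_fun add0r.
rewrite /curvature_at /curvature !covE.
rewrite [X in _ - X](_ : _ = 0) ?subr0//.
rewrite /cov /lie_bracket !derive_cst_fun subr0 add0r.
apply/rowP => k; rewrite !mxE big1// => i _; rewrite big1// => j _.
by rewrite mxE mulr0 mul0r.
Qed.

Lemma derive_row (f : 'rV[R]_n -> 'rV[R]_n) x u k : differentiable f x ->
  ('D_u f x) 0 k = 'D_u (fun y => f y 0 k : R^o) x.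
Proof. by move=> df; rewrite derive_mx; [rewrite mxE|exact: diff_derivable]. Qed.

(** In the contraction of the curvature only one term is not symmetric in [u]
    and [v]: the derivative along [u] of the contracted Christoffel symbols.  The
    quadratic term is symmetric because the trace of a product is. *)
Lemma Ric_sym (A : set 'rV[R]_n) G x u v : open A -> A x ->
  (forall a i j, Ck 1 A (fun x => G x a i j : R^o)) ->
  (forall y, A y -> forall k i j, G y k i j = G y k j i) ->
  'D_u (fun y => \tr (conn_form G y v) : R^o) x =
  'D_v (fun y => \tr (conn_form G y u) : R^o) x ->
  Ric G x u v = Ric G x v u.
Proof.
move=> oA Ax CG sG Dtr.
have nA : \forall y \near x, A y by exact: open_nbhs_nbhs.
have sGam a b : \forall y \near x, Gamma G y a b = Gamma G y b a.
  by apply: filterS nA => y Ay; apply: Gamma_sym; exact: sG.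
have dGam a b : differentiable (fun y => Gamma G y a b) x.
  by have [+ _] := Ck_Gamma a b oA CG; exact.
have R1 a b : \sum_k ('D_a (fun y => Gamma G y 'e_k b) x) 0 k =
    'D_a (fun y => \tr (conn_form G y b) : R^o) x.
  have E : \forall y \near x, \tr (conn_form G y b) =
      (\sum_k (fun y => Gamma G y 'e_k b 0 k : R^o)) y.
    apply: filterS nA => y Ay; rewrite fct_sumE; apply: eq_bigr => k _.
    by rewrite (Gamma_sym _ _ (sG y Ay)) -mul_conn_form -rowE [RHS]mxE.
  have dk k : differentiable (fun y => Gamma G y 'e_k b 0 k : R^o) x.
    exact: (@differentiable_comp R _ _ _ (fun y => Gamma G y 'e_k b)
      (fun r : 'rV[R]_n => r 0 k : R^o) x (dGam 'e_k b) (differentiable_coord _ 0 k)).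
  rewrite (near_eq_derive _ E) derive_sum => [|k]; last exact: diff_derivable.
  by apply: eq_bigr => k _; rewrite derive_row.
have R2 a b : \sum_k (Gamma G x a (Gamma G x 'e_k b)) 0 k =
    \tr (conn_form G x b *m conn_form G x a).
  apply: eq_bigr => k _; rewrite (Gamma_sym 'e_k b (sG x Ax)) -!mul_conn_form.
  by rewrite -mulmxA -rowE [LHS]mxE.
have RicE a b : Ric G x a b =
    'D_a (fun y => \tr (conn_form G y b) : R^o) x
    + \tr (conn_form G x b *m conn_form G x a)
    - \sum_k ('D_'e_k (fun y => Gamma G y a b) x + Gamma G x 'e_k (Gamma G x a b)) 0 k.
  rewrite -R1 -R2 -big_split -sumrB /Ric; apply: eq_bigr => k _.
  by rewrite /lin1_mx [LHS]mxE curvature_atE !mxE.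
rewrite !RicE Dtr mxtrace_mulC; congr (_ - _); apply: eq_bigr => k _.
by rewrite (near_eq_derive _ (sGam u v)) (Gamma_sym u v (sG x Ax)).
Qed.

Definition form_at (w : 'rV[R]_n -> 'I_n -> R) x u : R := \sum_i w x i * u 0 i.

Lemma form_at_delta w x i : form_at w x 'e_i = w x i.
Proof.
rewrite /form_at (bigD1 i)//= mxE !eqxx mulr1 big1 ?addr0// => j ji.
by rewrite mxE (negbTE ji) mulr0.
Qed.

(** The components of the connection nabla_X Y + w(X) Y + w(Y) X. *)
Definition projective_change G (w : 'rV[R]_n -> 'I_n -> R) : @components R n :=
  fun x k i j => G x k i j + (w x i * (k == j)%:R + w x j * (k == i)%:R).

Lemma Gamma_projective_change G w x u v :
  Gamma (projective_change G w) x u v =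
  Gamma G x u v + (form_at w x u *: v + form_at w x v *: u).
Proof.
have sel (f g : 'I_n -> R) k :
    \sum_i \sum_j (f i * (k == j)%:R) * (g j) = (\sum_i f i) * g k.
  rewrite mulr_suml; apply: eq_bigr => i _.
  rewrite (bigD1 k)//= eqxx mulr1 big1 ?addr0// => j jk.
  by rewrite eq_sym (negbTE jk) mulr0 mul0r.
apply/rowP => k; rewrite !mxE /form_at -(sel _ (v 0)) -(sel _ (u 0)).
rewrite [X in _ = _ + (_ + X)]exchange_big -!big_split; apply: eq_bigr => i _ /=.
rewrite -!big_split; apply: eq_bigr => j _ /=.
by rewrite /projective_change; ring.
Qed.

(** The identity contributes n, and the rank-one term contributes one more. *)
Lemma tr_conn_form_change G w x u :
  \tr (conn_form (projective_change G w) x u) =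
  \tr (conn_form G x u) + n.+1%:R * form_at w x u.
Proof.
have trE H : \tr (conn_form H x u) = \sum_k (Gamma H x u 'e_k) 0 k.
  by apply: eq_bigr => k _; rewrite -mul_conn_form -rowE [RHS]mxE.
rewrite !trE; under eq_bigr do rewrite Gamma_projective_change mxE.
rewrite big_split /=; congr (_ + _).
under eq_bigr => k _ do rewrite !mxE !eqxx mulr1 form_at_delta.
by rewrite big_split /= sumr_const card_ord -/(form_at w x u) -[in RHS]natr1 mulrDl mul1r mulr_natl.
Qed.

End Components.

(** * The equiaffine connection *)

Section EquiaffineConnection.
Context {R : realType} {n : nat} (M : manifold R n).
Variables (nabla : affine_connection M) (d : density M).
Hypothesis nablaC1 : connection_C1 nabla.
Hypothesis d_gt0 : forall c x, atlas c -> cod c x -> 0 < d c x.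
Implicit Types (c : chart R n M) (x u v : 'rV[R]_n) (p : M).

(** The one-form which turns the contracted Christoffel symbols into half the
    logarithmic derivative of the density. *)
Definition psi c x (i : 'I_n) : R :=
  n.+1%:R^-1 * ('D_'e_i (d c) x / (2 * d c x) - \tr (conn_form (nabla c) x 'e_i)).

Lemma differentiable_dens c x : atlas c -> cod c x -> differentiable (d c) x.
Proof. by move=> ac cx; have [+ _] := dens_smooth d ac 1; exact. Qed.

Lemma tr_conn_form_linear (G : @components R n) x u :
  \tr (conn_form G x u) = \sum_i \tr (conn_form G x 'e_i) * u 0 i.
Proof.
have E i : \tr (conn_form G x 'e_i) = \sum_k G x k i k.
  apply: eq_bigr => k _; rewrite mxE (bigD1 i)//= mxE !eqxx mulr1.
  by rewrite big1 ?addr0// => j ji; rewrite mxE (negbTE ji) mulr0.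
under [RHS]eq_bigr do rewrite E mulr_suml.
by rewrite exchange_big; apply: eq_bigr => k _; rewrite mxE.
Qed.

Lemma form_at_psi c x u : atlas c -> cod c x -> form_at (psi c) x u =
  n.+1%:R^-1 * ('D_u (d c) x / (2 * d c x) - \tr (conn_form (nabla c) x u)).
Proof.
move=> ac cx; have dd := differentiable_dens ac cx.
rewrite tr_conn_form_linear (deriveE u dd) {2}(row_sum_delta u) linear_sum.
rewrite mulr_suml -sumrB mulr_sumr; apply: eq_bigr => i _.
rewrite linearZ /= -(deriveE 'e_i dd) /psi -[_ *: _]/(u 0 i * 'D_'e_i (d c) x); ring.
Qed.

(** The transformation law of the Christoffel symbols says N J = D_u J + J N' for
    the connection matrices [N], [N'] and the Jacobian matrix [J].  Multiply by
    the inverse of [J], take traces and use Jacobi's formula. *)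
Lemma tr_conn_form_transition c c' x u : atlas c -> atlas c' -> overlap c c' x ->
  \tr (conn_form (nabla c) x u) =
  'D_u (fun y => \det (jac c c' y) : R^o) x / \det (jac c c' x)
  + \tr (conn_form (nabla c') (transition c c' x) ('D_u (transition c c') x)).
Proof.
move=> ac ac' o; set tau := transition c c'; set J := jac c c' x.
pose K := jac c' c (tau x).
have JK : J *m K = 1%:M := jac_inv ac ac' o.
have KJ : K *m J = 1%:M := mulmx1C JK.
pose DJ : 'M[R]_n := \matrix_(i, j) 'D_u (fun y => jac c c' y i j : R^o) x.
set N := conn_form (nabla c) x u; set N' := conn_form _ _ ('D_u tau x).
have dJ i j : differentiable (fun y => jac c c' y i j : R^o) x.
  by have [+ _] := smooth_jac i j ac ac' 1; exact.
(* row i is the transformation law for the directions u and e_i *)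
have NJ : N *m J = DJ + J *m N'.
  apply/row_matrixP => i; rewrite raddfD /= rowE mulmxA mul_conn_form.
  have <- := derive_jac (Gamma (nabla c) x u 'e_i) ac ac' o.
  rewrite -christoffel_transform//; congr (_ + _); last first.
    rewrite row_mul -mul_conn_form; congr (_ *m _).
    by rewrite rowE -(derive_jac 'e_i ac ac' o).
  have dDtau : differentiable ('D_'e_i tau) x.
    by have [_ /(_ 'e_i) [+ _]] := smooth_transition ac ac' 2; exact.
  apply/rowP => j; rewrite [RHS]mxE mxE derive_row//.
  apply: near_eq_derive; apply: filterS (near_overlap o) => y oy.
  by rewrite jacE.
have -> : N = DJ *m K + J *m N' *m K.
  by rewrite -mulmxDl -NJ -mulmxA JK mulmx1.
rewrite mxtraceD (mxtrace_mulC (J *m N') K) mulmxA KJ mul1mx; congr (_ + _).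
have J0 := det_jac_neq0 ac ac' o.
by rewrite (derive_det u dJ JK) -/DJ mulrC mulKf.
Qed.

Lemma log_derivative_product (a b e f : R) : a != 0 -> f != 0 ->
  (a * (f * b + b * f) + e * (f * f)) / (2 * (a * (f * f))) = e / (2 * a) + b / f.
Proof. by move=> a0 f0; field; rewrite a0 f0. Qed.

(** Logarithmic derivative of the transformation law of the density; the factor
    2 in the denominators compensates the square of the determinant. *)
Lemma derive_dens_transition c c' x u : atlas c -> atlas c' -> overlap c c' x ->
  'D_u (d c) x / (2 * d c x) =
  'D_('D_u (transition c c') x) (d c') (transition c c' x)
    / (2 * d c' (transition c c' x))
  + 'D_u (fun y => \det (jac c c' y) : R^o) x / \det (jac c c' x).
Proof.
move=> ac ac' o; pose tau := transition c c'.
pose D : 'rV[R]_n -> R^o := fun y => \det (jac c c' y).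
have dD : differentiable D x by have [+ _] := smooth_det_jac ac ac' 1; exact.
have D0 : D x != 0 := det_jac_neq0 ac ac' o.
have o' := overlap_cod (overlap_sym o).
have dd := differentiable_dens ac' o'.
have dt := differentiable_transition ac ac' o.
have ddt : differentiable (d c' \o tau) x by exact: differentiable_comp.
have DD2 : differentiable (fun y => D y *: D y : R^o) x by have [] := diff_scale dD dD.
have E : \forall y \near x, d c y = (d c' \o tau) y *: (D y *: D y).
  by apply: filterS (near_overlap o) => y oy; exact: (dens_transform d ac ac' oy).
rewrite (near_eq_derive _ E) (nbhs_singleton E) (derive_scale u ddt DD2).
have E2 : 'D_u (d c' \o tau) x = _ := derive_comp u dt dd.
have E1 := derive_scale u dD dD.
rewrite E1 E2.
have a0 : d c' (tau x) != 0 by exact/lt0r_neq0/d_gt0.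
exact: log_derivative_product.
Qed.

Lemma psi_transform c c' x u : atlas c -> atlas c' -> overlap c c' x ->
  form_at (psi c) x u =
  form_at (psi c') (transition c c' x) ('D_u (transition c c') x).
Proof.
move=> ac ac' o; rewrite (form_at_psi u ac (overlap_cod o)).
rewrite (form_at_psi _ ac' (overlap_cod (overlap_sym o))); congr (_ * _).
rewrite (tr_conn_form_transition u ac ac' o) (derive_dens_transition u ac ac' o).
by rewrite addrKA.
Qed.

Lemma equiaffine_christoffel_transform c c' : atlas c -> atlas c' ->
  forall x u v, overlap c c' x ->
  let tau := transition c c' in
  'D_u ('D_v tau) x
    + Gamma (projective_change (nabla c') (psi c')) (tau x) ('D_u tau x) ('D_v tau x)
  = 'D_(Gamma (projective_change (nabla c) (psi c)) x u v) tau x.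
Proof.
move=> ac ac' x u v o tau.
have dt := differentiable_transition ac ac' o.
rewrite !Gamma_projective_change addrA (christoffel_transform nabla ac ac' u v o).
rewrite !(derive_addr _ _ dt) !(derive_scaler _ _ dt).
by rewrite (psi_transform u ac ac' o) (psi_transform v ac ac' o).
Qed.

Definition equiaffine_connection : affine_connection M :=
  @AffineConnection R n M (fun c => projective_change (nabla c) (psi c))
    equiaffine_christoffel_transform.

Lemma psi_C1 c i : atlas c -> Ck 1 (cod c) (fun x => psi c x i : R^o).
Proof.
move=> ac; have oc := @cod_open _ _ _ c.
have Cd k : Ck k (cod c) (d c) by exact: dens_smooth.
apply: CkM => //; first exact: Ck_cst.
apply: CkB => //; last by apply: Ck_tr_conn_form => // a j k; exact: nablaC1.
apply: CkM => //; first by have [_] := Cd 2; exact.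
apply: CkV => // [x cx|].
  by rewrite mulf_neq0// ?pnatr_eq0// lt0r_neq0// d_gt0.
by apply: CkM => //; exact: Ck_cst.
Qed.

Lemma equiaffine_connection_C1 : connection_C1 equiaffine_connection.
Proof.
move=> c ac k i j; have oc := @cod_open _ _ _ c.
apply: (@CkD _ _ _ 1 _ (fun x => nabla c x k i j : R^o) (fun x =>
  psi c x i * (k == j)%:R + psi c x j * (k == i)%:R : R^o)) => //.
  exact: nablaC1.
by apply: CkD => //; apply: CkM => //; solve [exact: Ck_cst|exact: psi_C1].
Qed.

Lemma equiaffine_connection_torsion_free :
  torsion_free nabla -> torsion_free equiaffine_connection.
Proof.
move=> tf X Y c ac x cx; rewrite -(tf X Y c ac x cx) /cov /=.
rewrite !Gamma_projective_change.
rewrite (addrC (form_at (psi c) x (Y c x) *: _)).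
rewrite (addrA ('D_(X c x) (Y c) x)) (addrA ('D_(Y c x) (X c) x)).
by rewrite [X in _ - X]addrC addrKA.
Qed.

(** The contracted Christoffel symbols of the new connection are D d / (2 d), a
    closed form by the symmetry of second derivatives. *)
Lemma equiaffine_connection_equiaffine :
  torsion_free nabla -> equiaffine equiaffine_connection.
Proof.
move=> tf c ac x u v cx; have oc := @cod_open _ _ _ c.
apply: (Ric_sym oc cx).
- by move=> a i j; exact: equiaffine_connection_C1.
- move=> y cy k i j /=; rewrite /projective_change (torsion_free_sym _ _ _ tf ac cy).
  by congr (_ + _); rewrite addrC.
have n0 : n.+1%:R != 0 :> R by rewrite pnatr_eq0.
have E a : \forall y \near x,
    \tr (conn_form (equiaffine_connection c) y a) = 'D_a (d c) y *: (2 * d c y)^-1.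
  apply: filterS (open_nbhs_nbhs (conj oc cx)) => y cy.
  rewrite tr_conn_form_change (form_at_psi a ac cy) mulVKf//.
  by rewrite addrC subrK.
have Cd k : Ck k (cod c) (d c) by exact: dens_smooth.
have dd a : differentiable ('D_a (d c)) x by have [_ /(_ a) [+ _]] := Cd 2; exact.
have d2 : differentiable (fun y => 2 * d c y : R^o) x.
  have C2 : Ck 1 (cod c) (fun y => 2 * d c y : R^o) by apply: CkM => //; exact: Ck_cst.
  by have [+ _] := C2; exact.
have d20 : 2 * d c x != 0 by rewrite mulf_neq0// ?pnatr_eq0// lt0r_neq0// d_gt0.
have dV : differentiable (fun y => (2 * d c y)^-1 : R^o) x by exact: differentiableV.
have DV a : 'D_a (fun y => (2 * d c y)^-1 : R^o) x =
    - (2 * d c x) ^- 2 * 2 * 'D_a (d c) x.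
  rewrite deriveV//; last exact: diff_derivable.
  rewrite -[X in _ *: X]/('D_a (fun y => (2 : R) *: d c y) x).
  rewrite (@deriveZ _ _ _ (d c)); last exact/diff_derivable/differentiable_dens.
  by rewrite /GRing.scale /= mulrA.
rewrite (near_eq_derive _ (E u)) (near_eq_derive _ (E v)).
rewrite (derive_scale u (dd v) dV) (derive_scale v (dd u) dV) !DV.
rewrite (derive_schwarz u v oc (Cd 2) cx); congr (_ + _).
by rewrite /GRing.scale /=; ring.
Qed.

End EquiaffineConnection.

(** * Primitives and inverse functions on an open interval *)

Section Reparametrizations.
Context {R : realType}.
Implicit Types (I J : set R) (s t : R).

Lemma open_interval_margin I s t : open I -> I s -> I t ->
  exists a b, [/\ I a, I b, a < s < b & a < t < b].
Proof.
move=> oI.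
wlog st : s t / s <= t.
  move=> H Is It; case: (leP s t) => [/H|/ltW/H] => [|]; first exact.
  by move=> /(_ It Is) [a [b [? ? ? ?]]]; exists a, b.
have mar r : I r -> exists e, [/\ 0 < e, I (r - e) & I (r + e)].
  move=> Ir; have /nbhs_ballP[e /= e0 eI] := open_nbhs_nbhs (conj oI Ir).
  have e2 : `|e / 2| < e by rewrite gtr0_norm ?divr_gt0// ltr_pdivrMr// ltr_pMr// ltr1n.
  exists (e / 2); split; first by rewrite divr_gt0.
    by apply: eI; rewrite -ball_normE /= opprB addrC subrK.
  by apply: eI; rewrite -ball_normE /= opprD addrA subrr add0r normrN.
move=> /mar [e [e0 Ia _]] /mar [f [f0 _ Ib]].
by exists (s - e), (t + f); split=> //; apply/andP; split; lra.
Qed.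

(** The integral is split at [t0] to cover both sides of it.  Near a given point
    it differs by a constant from an integral with a fixed lower bound in [I], to
    which the fundamental theorem of calculus applies. *)
Lemma primitive I (p : R -> R) t0 : open I -> is_interval I -> I t0 ->
  (forall t, I t -> {for t, continuous p}) ->
  exists P : R -> R, forall t, I t -> is_derive t 1 P (p t).
Proof.
move=> oI iI It0 pc; pose mu := @lebesgue_measure R.
pose F t : R := (\int[mu]_(y in [set` `]t0, t]]) p y)
              - (\int[mu]_(y in [set` `]t, t0]]) p y).
exists F => t It.
have [a [b [Ia Ib /andP[at0 t0b] /andP[ta tb]]]] := open_interval_margin oI It0 It.
have pint u v : a <= u -> v <= b -> mu.-integrable [set` `[u, v]] (EFin \o p).
  move=> au vb; apply: continuous_compact_integrable; first exact: segment_compact.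
  apply: continuous_in_subspaceT => y; rewrite inE /= in_itv /= => /andP[uy yv].
  by apply: pc; apply: (iI a b) => //; rewrite (le_trans au uy) (le_trans yv vb).
pose G s : R := \int[mu]_(y in [set` `[a, s]]) p y.
have FG : \forall s \near t, G s - G t0 = F s.
  near=> s.
  have as_ : a < s by near: s; exact: lt_nbhsr.
  have sb : s < b by near: s; exact: lt_nbhsl.
  rewrite /F; have [t0s|st0] := leP t0 s.
    rewrite [X in _ = _ - X](_ : _ = 0) ?subr0; last first.
      by rewrite set_itv_ge ?Rintegral_set0// bnd_simp -leNgt.
    by apply: Rintegral_itvB; rewrite ?bnd_simp ?(ltW at0)//; exact: pint (lexx _) (ltW sb).
  rewrite [X in _ = X - _](_ : _ = 0) ?sub0r; last first.
    by rewrite set_itv_ge ?Rintegral_set0// bnd_simp -leNgt ltW.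
  rewrite -opprB; congr (- _).
  by apply: Rintegral_itvB; rewrite ?bnd_simp ?(ltW as_) ?(ltW st0)//;
    exact: pint (lexx _) (ltW t0b).
have [dG0 GE] := continuous_FTC1_closed tb (pint a b (lexx _) (lexx _)) ta (pc t It).
have D1G : 'D_1 G t = p t := etrans (esym (derive1E G t)) GE.
have dG : is_derive t 1 G (p t) := DeriveDef dG0 D1G.
suff dF : is_derive t 1 (fun s => G s - G t0) (p t) by exact: near_eq_is_derive FG dF.
by rewrite -[p t]subr0; exact: is_deriveB dG (is_derive_cst _ _ _).
Unshelve. all: by end_near. Qed.

Lemma inverse_on_interval I (f df : R -> R) : open I -> is_interval I ->
  (forall t, I t -> is_derive t 1 f (df t)) -> (forall t, I t -> 0 < df t) ->
  exists h : R -> R, [/\ open (f @` I), is_interval (f @` I),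
    forall t, I t -> h (f t) = t &
    forall t, I t -> is_derive (f t) 1 h (df t)^-1].
Proof.
move=> oI iI fdf df0.
have fc s t : I s -> I t -> {within `[s, t], continuous f}.
  move=> Is It; apply: derivable_within_continuous => y.
  rewrite in_itv /= => syt; have Iy := iI s t Is It y syt.
  by have [] := fdf y Iy.
have fI s t : I s -> I t -> s < t -> f s < f t.
  move=> Is It st.
  have dI y : y \in `]s, t[ -> I y.
    by rewrite in_itv /= => /andP[sy yt]; apply: (iI s t) => //; rewrite !ltW.
  have [y yst E] := @MVT R f df s t st (fun y yst => fdf y (dI y yst)) (fc s t Is It).
  by rewrite -subr_gt0 E mulr_gt0 ?subr_gt0//; exact/df0/dI.
have finj s t : I s -> I t -> f s = f t -> s = t.
  move=> Is It; case: (ltgtP s t) => // [/(fI _ _ Is It)|/(fI _ _ It Is)] + E;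
  by rewrite E ltxx.
have iJ : is_interval (f @` I).
  move=> _ _ [s Is <-] [t It <-] z /andP[sz zt].
  have [st|ts] := leP s t; last first.
    by have := lt_le_trans (fI _ _ It Is ts) (le_trans sz zt); rewrite ltxx.
  have fst : f s <= f t by exact: le_trans sz zt.
  have [|c] := IVT st (fc s t Is It) (v := z).
    by rewrite min_l// max_r// sz.
  by rewrite in_itv /= => sct <-; exists c => //; exact: iI sct.
have oJ : open (f @` I).
  rewrite openE => _ [t It <-].
  have [a [b [Ia Ib /andP[at_ tb] _]]] := open_interval_margin oI It It.
  have fa := fI a t Ia It at_; have fb := fI t b It Ib tb.
  near=> z; apply: (iJ (f a) (f b)); [by exists a|by exists b|].
  by apply/andP; split; apply: ltW; near: z; [exact: lt_nbhsr|exact: lt_nbhsl].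
have /choice[h hP] s : exists t, (f @` I) s -> I t /\ f t = s.
  have [[t It <-]|ns] := pselect ((f @` I) s); last by exists 0.
  by exists t.
have hK t : I t -> h (f t) = t.
  by move=> It; have [|Ih fh] := hP (f t); [exists t|exact: finj fh].
exists h; split=> // t It; apply: is_derive_inverse.
- by apply: filterS (open_nbhs_nbhs (conj oI It)) => y; exact: hK.
- apply: filterS (open_nbhs_nbhs (conj oI It)) => y Iy.
  by apply/differentiable_continuous/derivable1_diffP; have [] := fdf y Iy.
- exact: fdf.
- exact/lt0r_neq0/df0.
Unshelve. all: by end_near. Qed.

Lemma derive_scal1 (V : normedModType R) (f : R^o -> V) s (a : R) :
  differentiable f s -> 'D_a f s = a *: 'D_1 f s.
Proof. by move=> df; rewrite -derive_scaler// [_ *: _]mulr1. Qed.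

Lemma Ck_is_derive (V : normedModType R) k (A : set R^o) (f df : R^o -> V) : open A ->
  (forall s, A s -> differentiable f s /\ 'D_1 f s = df s) ->
  Ck k A df -> Ck k.+1 A f.
Proof.
move=> oA fdf Cdf; split=> [s /fdf []//|v].
have := Ck_scale oA (Ck_cst k A (v : R^o)) Cdf.
apply: Ck_ext => // s /fdf [df1 <-].
by rewrite (derive_scal1 v).
Qed.

End Reparametrizations.

(** * Geodesics of a projective change *)

Section GeodesicMapping.
Context {R : realType} {n : nat} (M : manifold R n).
Implicit Types (c : chart R n M).
Variables (nabla nabla' : affine_connection M).
Variable w : chart R n M -> 'rV[R]_n -> 'I_n -> R.
Hypothesis w_continuous : forall c i x, atlas c -> cod c x ->
  {for x, continuous (fun x => w c x i : R^o)}.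
Hypothesis w_transform : forall c c' x u, atlas c -> atlas c' -> overlap c c' x ->
  form_at (w c) x u = form_at (w c') (transition c c' x) ('D_u (transition c c') x).
Hypothesis nabla'E : forall c, nabla' c = projective_change (nabla c) (w c).

Lemma diffeomorphism_id : diffeomorphism (fun p : M => p).
Proof.
have s : smooth_map (fun p : M => p).
  split; first by move=> p; exact: cvg_id.
  by move=> c c' ac ac'; exact: smooth_transition ac ac'.
by split=> //; exists id.
Qed.

Lemma Ck_set0 (V W : normedModType R) k (f : V -> W) : Ck k set0 f.
Proof. by apply: Ck_local. Qed.


Section Curve.
Variables (I : set R) (g : R -> M).
Hypothesis geo : geodesic nabla I g.

Definition curve (c : chart R n M) : R^o -> 'rV[R]_n := cmap c \o g.

Definition curve_dom (c : chart R n M) : set R^o := I `&` g @^-1` dom c.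

Lemma curve_dom_open c : open (curve_dom c).
Proof.
case: geo => oI _ gc _; rewrite openE => t [It ct].
apply: filterI; first exact: open_nbhs_nbhs.
exact: gc It _ (open_nbhs_nbhs (conj (dom_open c) ct)).
Qed.

Lemma curve_C2 c : atlas c -> Ck 2 (curve_dom c) (curve c).
Proof. by case: geo => _ _ _ /[apply] -[]. Qed.

Lemma differentiable_curve c t : atlas c -> curve_dom c t -> differentiable (curve c) t.
Proof. by move=> ac ct; have [+ _] := curve_C2 ac; exact. Qed.

Lemma curve_cod c t : curve_dom c t -> cod c (curve c t).
Proof. by move=> [_ ct]; exact: cod_cmap. Qed.

(** The value of the one-form [w] on the velocity of the curve. *)
Definition form_along (c : chart R n M) (t : R^o) : R :=
  form_at (w c) (curve c t) ('D_1 (curve c) t).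

Lemma form_along_chart c c' t : atlas c -> atlas c' -> curve_dom c t -> curve_dom c' t ->
  form_along c t = form_along c' t.
Proof.
move=> ac ac' ct c't; have o : overlap c c' (curve c t).
  apply/overlapP; split; first exact: curve_cod.
  by rewrite /curve /= cmapK; [exact: c't.2|exact: ct.2].
have E : \forall s \near t, (transition c c' \o curve c) s = curve c' s.
  apply: filterS (open_nbhs_nbhs (conj (@curve_dom_open c) ct)) => s [_ cs].
  by rewrite /curve /transition /= cmapK.
rewrite /form_along (w_transform _ ac ac' o).
have Et : transition c c' (curve c t) = curve c' t := nbhs_singleton E.
have -> : 'D_1 (curve c') t = 'D_('D_1 (curve c) t) (transition c c') (curve c t).
  rewrite -(near_eq_derive _ E) derive_comp//; first exact: differentiable_curve.
  exact: differentiable_transition.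
by rewrite Et.
Qed.

Lemma form_along_continuous c t : atlas c -> curve_dom c t ->
  {for t, continuous (form_along c : R -> R)}.
Proof.
move=> ac ct; have oc := @curve_dom_open c.
suff C0 : Ck 0 (curve_dom c) (form_along c : R^o -> R^o) by exact: C0 ct.
have D1 : Ck 1 (curve_dom c) ('D_1 (curve c)) := (curve_C2 ac).2 1.
have {}D1 := CkS D1.
apply: Ck_sum => // i _; apply: CkM => //; last exact: ((Ck_rowP _ _ oc).1 D1 i).
move=> s cs; apply: (@continuous_comp _ _ _ (curve c) (fun x => w c x i : R^o)).
  exact/differentiable_continuous/differentiable_curve.
by apply: w_continuous => //; exact: curve_cod.
Qed.

(** The local expressions agree on overlaps, so choosing a chart at each
    parameter gives one continuous function. *)
Lemma form_along_extends : exists p : R -> R,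
  (forall c t, atlas c -> curve_dom c t -> p t = form_along c t) /\
  (forall t, I t -> {for t, continuous p}).
Proof.
have /choice[ch chP] (q : M) : exists c, atlas c /\ dom c q.
  by have [c ac cq] := atlas_cover q; exists c.
pose p t := form_along (ch (g t)) t.
have pE c t : atlas c -> curve_dom c t -> p t = form_along c t.
  move=> ac ct; have [a0 d0] := chP (g t).
  by apply: form_along_chart => //; split=> //; exact: ct.1.
exists p; split=> // t It; have [ac dc] := chP (g t).
have ct : curve_dom (ch (g t)) t by [].
have /= sc := form_along_continuous ac ct.
have E : \forall s \near t, form_along (ch (g t)) s = p s.
  by apply: filterS (open_nbhs_nbhs (conj (@curve_dom_open _) ct)) => s; move/pE->.
rewrite /prop_for /continuous_at -(nbhs_singleton E).
by apply: cvg_trans sc; apply: near_eq_cvg; apply: filterS E => s ->.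
Qed.

(** With P' = w(g') and s' = q = exp (2 P), the inverse [h] of [s] has derivative
    [k = 1 / (q o h)], and k' = - 2 w(g' o h) k^2.  The acceleration of [g o h] is
    then k^2 g'' - 2 k^2 w(g') g' at [h r], which cancels the terms added by the
    projective change. *)
Lemma geodesic_reparametrization :
  exists J h, reparametrization J I h /\ geodesic nabla' J (g \o h).
Proof.
have [oI iI gc _] := geo.
have [[t0 It0]|I0] := pselect (I !=set0); last first.
  have -> : I = set0 by apply/seteqP; split=> // t It; case: I0; exists t.
  exists set0, id; split.
    split; [exact: open0|by move=> ? ? []|by rewrite image_id|exact: Ck_set0|].
    by move=> ? [].
  split; [exact: open0|by move=> ? ? []|by move=> ? []|].
  by move=> c ac; split=> [|? []]; rewrite set0I; exact: Ck_set0.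
have [p [pE pc]] := form_along_extends.
have [P dP] := primitive oI iI It0 pc.
pose q t := expR (2 * P t).
have q0 t : 0 < q t by exact: expR_gt0.
have dq t : I t -> is_derive t 1 q (2 * p t * q t).
  move=> It; have d2P : is_derive t 1 (fun t => 2 * P t) (2 * p t).
    by have dPt := dP t It; exact: is_deriveZ.
  by have := @is_derive1_comp R expR _ t _ _ (is_derive_expR _) d2P; rewrite mulrC.
have qc t : I t -> {for t, continuous q}.
  move=> It; apply/differentiable_continuous/derivable1_diffP.
  by have [] := dq t It.
have [s ds] := primitive oI iI It0 qc.
have [h [oJ iJ hK dh]] := inverse_on_interval oI iI ds (fun t _ => q0 t).
set J := s @` I in oJ iJ.
have hI r : J r -> I (h r) by move=> [t It <-]; rewrite hK.
have {}dh r : J r -> is_derive r 1 h (q (h r))^-1.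
  by move=> [t It <-]; rewrite hK//; exact: dh.
pose k r : R := (q (h r))^-1.
have dk r : J r -> is_derive r 1 k (- 2 * p (h r) * k r ^+ 2).
  move=> Jr.
  have dqh := is_derive1_comp (dq _ (hI r Jr)) (dh r Jr).
  have dV := is_deriveV (f := q \o h) (lt0r_neq0 (q0 (h r))) dqh.
  apply: (is_derive_eq dV); rewrite /k /GRing.scale /=; field.
  exact/lt0r_neq0.
have diff_h r : J r -> differentiable (h : R^o -> R^o) r.
  by move=> Jr; apply/derivable1_diffP; have [] := dh r Jr.
have diff_k r : J r -> differentiable (k : R^o -> R^o) r.
  by move=> Jr; apply/derivable1_diffP; have [] := dk r Jr.
have D1h r : J r -> 'D_1 h r = k r by move=> Jr; have [] := dh r Jr.
have Ck2 : Ck 2 J (h : R^o -> R^o).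
  apply: (@Ck_is_derive _ _ 1 J h k) => // [r Jr|].
    by split; [exact: diff_h|exact: D1h].
  apply: (@Ck_is_derive _ _ 0 J k (fun r => - 2 * p (h r) * k r ^+ 2)) => // [r Jr|].
    by split; [exact: diff_k|have [] := dk r Jr].
  have kC : Ck 0 J (k : R^o -> R^o).
    by move=> r Jr; exact/differentiable_continuous/diff_k.
  apply: CkM => //; last exact: CkM.
  apply: CkM => //; first exact: Ck_cst.
  move=> r Jr; apply: (@continuous_comp _ _ _ h p); last exact/pc/hI.
  exact/differentiable_continuous/diff_h.
have hJ : h @` J = I.
  apply/seteqP; split=> [_ [r Jr <-]|t It]; first exact: hI.
  by exists (s t); [exists t|exact: hK].
exists J, h; split.
  by split=> // r Jr; rewrite derive1E D1h// invr_neq0// lt0r_neq0.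
have gh r : J r -> {for r, continuous (g \o h)}.
  move=> Jr; apply: continuous_comp; last exact/gc/hI.
  exact/differentiable_continuous/diff_h.
split=> // c ac.
pose B : set R^o := J `&` (g \o h) @^-1` dom c.
have oB : open B.
  rewrite openE => r [Jr cr]; apply: filterI; first exact: open_nbhs_nbhs.
  exact: gh Jr _ (open_nbhs_nbhs (conj (dom_open c) cr)).
have hB r : B r -> curve_dom c (h r) by move=> [Jr cr]; split=> //; exact: hI.
split.
  apply: (@Ck_comp _ _ _ _ (@scalar_coordinates R) 2 B (curve_dom c) h (curve c)) => //.
    by apply: Ck_sub Ck2 => r [].
  exact: curve_C2.
move=> r Jr cr; have Br : B r by [].
pose x := curve c; pose y := 'D_1 x (h r); pose z := 'D_1 ('D_1 x) (h r).
have D1xh r' : B r' -> 'D_1 (x \o h) r' = k r' *: 'D_1 x (h r').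
  move=> Br'; rewrite (derive_comp _ (diff_h r' Br'.1)).
    by rewrite (D1h r' Br'.1) derive_scal1//; apply: differentiable_curve => //; exact: hB.
  by apply: differentiable_curve => //; exact: hB.
have dxE : 'D_1 (x \o h) r = k r *: y by exact: D1xh.
have diff_Dx : differentiable ('D_1 x) (h r).
  have D1 : Ck 1 (curve_dom c) ('D_1 x) := (curve_C2 ac).2 1.
  by have [+ _] := D1; apply; exact: hB.
have ddxE : 'D_1 ('D_1 (x \o h)) r = k r *: (k r *: z) + 'D_1 k r *: y.
  have E : \forall r' \near r, 'D_1 (x \o h) r' = k r' *: ('D_1 x \o h) r'.
    by apply: filterS (open_nbhs_nbhs (conj oB Br)); exact: D1xh.
  have diff_Dxh : differentiable ('D_1 x \o h) r.
    by apply: differentiable_comp => //; exact: diff_h.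
  rewrite (near_eq_derive _ E) (derive_scale (1 : R^o) (diff_k r Jr) diff_Dxh).
  rewrite (derive_comp _ (diff_h r Jr) diff_Dx) (D1h r Jr).
  by rewrite derive_scal1.
have geo_eq : z + Gamma (nabla c) (x (h r)) y y = 0.
  case: geo => _ _ _ /(_ c ac) [_ /(_ (h r) (hI r Jr) cr)].
  by rewrite derive1E (_ : derive1 _ = 'D_1 x)// funeqE => ?; rewrite derive1E.
have -> : derive1 (cmap c \o (g \o h) : R^o -> 'rV[R]_n) = 'D_1 (x \o h).
  by rewrite funeqE => ?; rewrite derive1E.
rewrite derive1E ddxE dxE nabla'E Gamma_projective_change.
have evy : form_at (w c) (x (h r)) y = p (h r) by rewrite (pE c)//; exact: hB.
have evZ a : form_at (w c) (x (h r)) (a *: y) = a * p (h r).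
  by rewrite -evy /form_at mulr_sumr; apply: eq_bigr => i _; rewrite mxE mulrCA.
rewrite -[(cmap c \o (g \o h)) r]/(x (h r)) evZ GammaZl GammaZr.
have -> : 'D_1 k r = - 2 * p (h r) * k r ^+ 2 by have [] := dk r Jr.
rewrite -(addr0_eq geo_eq) !scalerN addrACA subrr add0r !scalerA -[X in _ + X]scalerDl -scalerDl.
by rewrite [X in X *: _](_ : _ = 0) ?scale0r//; ring.
Qed.

End Curve.

Theorem projective_change_geodesic_mapping :
  geodesic_mapping nabla nabla' (fun p : M => p).
Proof.
split; first exact: diffeomorphism_id.
by move=> I g geo; have [J [h]] := geodesic_reparametrization geo; exists J, h.
Qed.

End GeodesicMapping.

(** * Projective equiaffinity *)

Theorem mainTheorem1 (R : realType) (n : nat) (M : manifold R n)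
    (nabla : affine_connection M) :
  connection_C1 nabla -> torsion_free nabla ->
  exists nabla' : affine_connection M,
    [/\ connection_C1 nabla',
        torsion_free nabla',
        equiaffine nabla' &
        geodesic_mapping nabla nabla' (fun p : M => p)].
Proof.
move=> C1 tf; have [d d0] := positive_density M.
exists (equiaffine_connection nabla d0); split.
- exact: equiaffine_connection_C1.
- exact: equiaffine_connection_torsion_free.
- exact: equiaffine_connection_equiaffine.
apply: (@projective_change_geodesic_mapping _ _ _ _ _ (psi nabla d)) => //.
- by move=> c i x ac cx; exact: Ck_continuous (psi_C1 C1 d0 i ac) cx.
- exact: psi_transform d0.
Qed.
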